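(* Let $D$ be a division ring with center $F$, and let $G$ be a locally solvable subnormal subgroup of the multiplicative group $D^*$. If the $i$-th derived subgroup $G^{(i)}$ is algebraic over $F$ for some positive integer $i$, then $G\subseteq F$.
   Context: $D^*$ denotes the group of units (nonzero elements) of $D$. For a group $G$ and a positive integer $i$, $G^{(i)}$ denotes the $i$-th derived subgroup ($G^{(1)}=[G,G]$, $G^{(i+1)}=[G^{(i)},G^{(i)}]$). A group is locally solvable if every finitely generated subgroup is solvable. A subset $S\subseteq D$ is algebraic over $F$ if every element of $S$ is a root of a nonzero polynomial with coefficients in $F$. $D$ is not assumed to be finite-dimensional over $F$. *)

(* Defs.v *)
From HB Require Import structures.
From mathcomp Require Import all_boot all_algebra.
From mathcomp Require Import boolp classical_sets.

Set Implicit Arguments.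
Unset Strict Implicit.
Unset Printing Implicit Defensive.

Import GRing.Theory.
Local Open Scope classical_set_scope.

(* Subgroups of a possibly infinite group are sets [H : set gT] satisfying
   [is_subgroup]: MathComp's [{group gT}] requires a finite [gT]. *)

Definition is_subgroup (gT : groupType) (H : set gT) : Prop :=
  [/\ H 1%g,
      forall x y, H x -> H y -> H (x * y)%g
    & forall x, H x -> H (x^-1)%g].

Definition generated (gT : groupType) (S : set gT) : set gT :=
  smallest (@is_subgroup gT) S.

Definition commutator_subgroup (gT : groupType) (A B : set gT) : set gT :=
  generated [set z | exists x y, [/\ A x, B y & z = [~ x, y]%g]].

(* [derived H 0 = H], so that [derived H i] is H^(i) for every i >= 1. *)
Fixpoint derived (gT : groupType) (H : set gT) (i : nat) : set gT :=
  if i is j.+1 then commutator_subgroup (derived H j) (derived H j) else H.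

Definition is_solvable (gT : groupType) (H : set gT) : Prop :=
  exists n : nat, derived H n = [set 1%g].

Definition finitely_generated (gT : groupType) (H : set gT) : Prop :=
  exists s : seq gT, H = generated [set x | x \in s].

Definition locally_solvable (gT : groupType) (G : set gT) : Prop :=
  forall H : set gT,
    is_subgroup H -> H `<=` G -> finitely_generated H -> is_solvable H.

Definition is_normal (gT : groupType) (H K : set gT) : Prop :=
  [/\ is_subgroup H, is_subgroup K, H `<=` K
    & forall x y, H x -> K y -> H (x ^ y)%g].

Definition is_subnormal (gT : groupType) (H K : set gT) : Prop :=
  [/\ is_subgroup H, is_subgroup K
    & exists (r : nat) (N : nat -> set gT),
        [/\ N 0 = H, N r = K
          & forall k : nat, k < r -> is_normal (N k) (N k.+1)]].

(* The group of units; [{unit R}] of finalg is only available for finite R. *)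
Record units (R : unitRingType) : Type :=
  Units { units_val :> R; units_valP : units_val \is a GRing.unit }.

HB.instance Definition _ (R : unitRingType) := [isSub for @units_val R].
HB.instance Definition _ (R : unitRingType) := [Choice of units R by <:].

Local Open Scope ring_scope.

Definition units_one (R : unitRingType) : units R :=
  Units (unitr1 R).

Fact units_mul_subproof (R : unitRingType) (u v : units R) :
  val u * val v \is a GRing.unit.
Proof. by rewrite unitrMl ?(valP u) ?(valP v). Qed.

Definition units_mul (R : unitRingType) (u v : units R) : units R :=
  Units (units_mul_subproof u v).

Fact units_inv_subproof (R : unitRingType) (u : units R) :
  (val u)^-1 \is a GRing.unit.
Proof. by rewrite unitrV (valP u). Qed.

Definition units_inv (R : unitRingType) (u : units R) : units R :=
  Units (units_inv_subproof u).

Fact units_mulA (R : unitRingType) : associative (@units_mul R).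
Proof. by move=> u v w; apply/val_inj; rewrite /= mulrA. Qed.

Fact units_mul1 (R : unitRingType) : left_id (@units_one R) (@units_mul R).
Proof. by move=> u; apply/val_inj; rewrite /= mul1r. Qed.

Fact units_mulr1 (R : unitRingType) : right_id (@units_one R) (@units_mul R).
Proof. by move=> u; apply/val_inj; rewrite /= mulr1. Qed.

Fact units_mulV (R : unitRingType) :
  left_inverse (@units_one R) (@units_inv R) (@units_mul R).
Proof. by move=> u; apply/val_inj; rewrite /= mulVr ?(valP u). Qed.

Fact units_mulrV (R : unitRingType) :
  right_inverse (@units_one R) (@units_inv R) (@units_mul R).
Proof. by move=> u; apply/val_inj; rewrite /= mulrV ?(valP u). Qed.

HB.instance Definition _ (R : unitRingType) :=
  isGroup.Build (units R) (@units_mulA R) (@units_mul1 R) (@units_mulr1 R)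
    (@units_mulV R) (@units_mulrV R).

(* [GRing.field_axiom R] says that every nonzero element of R is a unit; it
   does not make R commutative, and 1 != 0 is part of [unitRingType]. *)
Definition is_division_ring (R : unitRingType) : Prop := GRing.field_axiom R.

Definition center (R : unitRingType) : set R :=
  [set x | forall y : R, x * y = y * x].
Arguments center R : clear implicits.

(* [root p x] evaluates p with its coefficients on the left of the powers of
   x; when F is contained in the center the side does not matter. *)
Definition algebraic_over (R : unitRingType) (F : set R) (x : R) : Prop :=
  exists p : {poly R}, [/\ p != 0, forall k : nat, F p`_k & root p x].

(* Main.v *)
From HB Require Import structures.
Require Import Defs.
From mathcomp Require Import all_boot all_algebra all_field.
From mathcomp Require Import boolp classical_sets.

(** The proof rests on two facts.

    (1) A solvable subnormal subgroup N of the unit group U of a division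
    ring is central in U.  Going up the derived series, N may be taken of
    class at most 2.  Every a in N is then a bounded left Engel element:
    [[u, a], ..., a] = 1 for all u in U, with a number of commutators
    depending only on the subnormal depth.  If b in U is such that
    c = [b, a] commutes with a and b, then c = 1: conjugation by a maps
    x = f b to c x for every f centralizing a and b, and the Engel identity
    applied to 1 + x is a polynomial identity in x with infinitely many roots
    f b, false at x = -1 if c <> 1.  When no infinite supply of f exists,
    a, b and the prime field generate a finite ring and Wedderburn's little
    theorem gives c = 1.  Hence N is abelian, and it commutes with its
    conjugates under the second group above it in the subnormal series (when
    there is one), so that its normal closure there is abelian and has smaller
    depth; the last case, N normal in U, is Hua's computation with u and 1 + u.

    (2) Put H = G^(i).  If x and y are in H, the group <x, y> is solvable and
    algebraic, so its F-span is a finite-dimensional division algebra; let U be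
    its unit group.  The finitely generated subgroups of M = H :&: U are
    solvable of F-dimension at most d, hence (Zassenhaus) of derived length
    bounded in terms of d, so that M is solvable, and central in U by (1).
    Therefore H is abelian, G is solvable, and (1) applies to G in D^*. *)

Set Implicit Arguments.
Unset Strict Implicit.
Unset Printing Implicit Defensive.

Import GRing.Theory.

(** * Subgroups of infinite groups *)

Section Subgroups.
Variable gT : groupType.
Implicit Types (A B H K N S : set gT) (x y a g : gT) (n m s : nat).
Local Open Scope classical_set_scope.
Local Open Scope group_scope.

Lemma subgroup1 H : is_subgroup H -> H 1. Proof. by case. Qed.

Lemma subgroupM H x y : is_subgroup H -> H x -> H y -> H (x * y).
Proof. by case=> _ HM _; apply: HM. Qed.

Lemma subgroupV H x : is_subgroup H -> H x -> H x^-1.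
Proof. by case=> _ _; apply. Qed.

Lemma subgroupX H x n : is_subgroup H -> H x -> H (x ^+ n).
Proof.
move=> sH Hx; elim: n => [|n IHn]; first by rewrite expg0; apply: subgroup1.
by rewrite expgS; apply: subgroupM.
Qed.

Lemma subgroupJ H x y : is_subgroup H -> H x -> H y -> H (x ^ y).
Proof.
move=> sH Hx Hy; rewrite conjgE.
by apply: subgroupM; [|apply: subgroupV|apply: subgroupM].
Qed.

Lemma subgroupR H x y : is_subgroup H -> H x -> H y -> H [~ x, y].
Proof.
move=> sH Hx Hy; rewrite commgEl.
by apply: subgroupM; [|apply: subgroupV|apply: subgroupJ].
Qed.

Lemma subgroupI H K : is_subgroup H -> is_subgroup K -> is_subgroup (H `&` K).
Proof.
move=> sH sK; split=> [|x y [Hx Kx] [Hy Ky]|x [Hx Kx]]; split.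
all: [> exact: subgroup1|exact: subgroup1|exact: subgroupM|exact: subgroupM
     |exact: subgroupV|exact: subgroupV].
Qed.

Lemma subgroup_centralizer S : is_subgroup [set x | forall y, S y -> commute y x].
Proof.
split=> [y _|x y cx cy z Sz|x cx z Sz]; first exact: commute1.
  by apply: commuteM; [apply: cx|apply: cy].
by apply/commuteV/cx.
Qed.

Lemma subgroup_preconj H g : is_subgroup H -> is_subgroup [set x | H (x ^ g)].
Proof.
move=> sH; split=> [|x y Hx Hy|x Hx] /=; first by rewrite conj1g; apply: subgroup1.
  by rewrite conjMg; apply: subgroupM.
by rewrite conjVg; apply: subgroupV.
Qed.

Lemma generated_subgroup S : is_subgroup (generated S).
Proof.
split=> [H [sH _]|x y Gx Gy H sSH|x Gx H sSH].
- exact: subgroup1.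
- by have [sH _] := sSH; apply: subgroupM => //; [apply: Gx|apply: Gy].
- by have [sH _] := sSH; apply: subgroupV => //; apply: Gx.
Qed.

Lemma sub_generated S : S `<=` generated S.
Proof. exact: sub_gen_smallest. Qed.

Lemma generated_sub S H : is_subgroup H -> S `<=` H -> generated S `<=` H.
Proof. exact: smallest_sub. Qed.

Lemma generatedS A B : A `<=` B -> generated A `<=` generated B.
Proof.
move=> sAB; apply: generated_sub; first exact: generated_subgroup.
by move=> x /sAB; apply: sub_generated.
Qed.

Lemma generatedJ S H g :
  is_subgroup H -> (forall x, S x -> H (x ^ g)) ->
  forall x, generated S x -> H (x ^ g).
Proof. by move=> sH SH x; apply: (generated_sub (subgroup_preconj g sH)). Qed.

Lemma generated_commute S x :
  (forall y, S y -> commute x y) -> forall y, generated S y -> commute x y.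
Proof.
move=> cS y /(@generated_sub _ _ (subgroup_centralizer [set x])); apply=> //.
by move=> z Sz w /= ->; apply: cS.
Qed.

Lemma commutator_subset A B H :
  is_subgroup H -> (forall x y, A x -> B y -> H [~ x, y]) ->
  commutator_subgroup A B `<=` H.
Proof.
by move=> sH AB; apply: generated_sub => // z [x [y [Ax By ->]]]; apply: AB.
Qed.

Lemma derived_subgroup H n : is_subgroup H -> is_subgroup (derived H n).
Proof. by case: n => // n _; apply: generated_subgroup. Qed.

Lemma mem_derivedS H n x y :
  derived H n x -> derived H n y -> derived H n.+1 [~ x, y].
Proof. by move=> Hx Hy; apply: sub_generated; exists x, y. Qed.

Lemma derived_subS H n : is_subgroup H -> derived H n.+1 `<=` derived H n.
Proof.
move=> sH; apply: commutator_subset; first exact: derived_subgroup.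
by move=> x y Hx Hy; apply: subgroupR => //; apply: derived_subgroup.
Qed.

Lemma derived_le H m n : is_subgroup H -> m <= n -> derived H n `<=` derived H m.
Proof.
move=> sH; elim: n => [|n IHn]; first by rewrite leqn0 => /eqP->.
rewrite leq_eqVlt => /predU1P[->//|lemn] x Hx.
by apply: (IHn lemn); apply: derived_subS.
Qed.

Lemma derived_sub H n : is_subgroup H -> derived H n `<=` H.
Proof. by move=> sH; apply: (@derived_le H 0). Qed.

Lemma derived_mono H K n : H `<=` K -> derived H n `<=` derived K n.
Proof.
move=> sHK; elim: n => // n IHn; apply: generatedS => _ [x [y [Hx Hy ->]]].
by exists x, y; split=> //; apply: IHn.
Qed.

Lemma derived_add H m n : derived (derived H m) n = derived H (m + n).
Proof. by elim: n => [|n IHn]; rewrite ?addn0 // addnS /= IHn. Qed.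

Lemma derivedJ H n g :
  (forall x, H x -> H (x ^ g)) -> forall x, derived H n x -> derived H n (x ^ g).
Proof.
move=> nHg; elim: n => // n IHn; apply: generatedJ.
  exact: generated_subgroup.
by move=> _ [x [y [Hx Hy ->]]]; rewrite conjRg; apply: mem_derivedS; apply: IHn.
Qed.

Lemma derived_trivial H m n :
  is_subgroup H -> m <= n -> derived H m = [set 1] -> derived H n = [set 1].
Proof.
move=> sH lemn Hm; apply/seteqP; split=> x.
  by move/(derived_le sH lemn); rewrite Hm.
by move=> ->; apply: subgroup1; apply: derived_subgroup.
Qed.

Lemma derived_commute H n :
  is_subgroup H -> (forall x y, derived H n x -> derived H n y -> commute x y) ->
  derived H n.+1 = [set 1].
Proof.
move=> sH cH; apply/seteqP; split=> [|x ->]; last exact: (subgroup1 (derived_subgroup n.+1 sH)).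
apply: commutator_subset => [|x y Hx Hy].
  by split=> [|x y -> ->|x ->]; rewrite /= ?mulg1 ?invg1.
by apply/eqP/commgP/cH.
Qed.

Lemma solvable_sub H K :
  is_subgroup H -> H `<=` K -> is_solvable K -> is_solvable H.
Proof.
move=> sH sHK [n Kn]; exists n; apply/seteqP; split=> x.
  by move/(derived_mono sHK); rewrite Kn.
by move=> ->; apply: subgroup1; apply: derived_subgroup.
Qed.

(** A nested commutator involves only finitely many elements of [H]. Bounds on the derived length of
    finitely generated subgroups thereby pass to [H] itself. *)
Lemma derived_generated H n x :
  derived H n x ->
  exists2 t : seq gT, (forall y, y \in t -> H y) &
    derived (generated [set y | y \in t]) n x.
Proof.
elim: n x => [|n IHn] x.
  move=> Hx; exists [:: x] => [y|]; first by rewrite inE => /eqP->.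
  by apply: sub_generated; rewrite /= inE.
pose P (x : gT) := exists2 t : seq gT, (forall y, y \in t -> H y) &
    derived (generated [set y | y \in t]) n.+1 x.
have gcat (t1 t : seq gT) m : {subset t1 <= t} ->
    derived (generated [set y | y \in t1]) m `<=`
    derived (generated [set y | y \in t]) m.
  by move=> st; apply: derived_mono; apply: generatedS => y /=; apply: st.
have cat1 (t1 t2 : seq gT) : {subset t1 <= t1 ++ t2}.
  by move=> y; rewrite mem_cat => ->.
have cat2 (t1 t2 : seq gT) : {subset t2 <= t1 ++ t2}.
  by move=> y; rewrite mem_cat orbC => ->.
have catH (t1 t2 : seq gT) : (forall y, y \in t1 -> H y) ->
    (forall y, y \in t2 -> H y) -> forall y, y \in t1 ++ t2 -> H y.
  by move=> h1 h2 y; rewrite mem_cat => /orP[/h1|/h2].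
apply: (@generated_sub _ (P : set gT)); last first.
  move=> _ [y [z [/IHn[t1 Ht1 Dy] /IHn[t2 Ht2 Dz] ->]]].
  exists (t1 ++ t2); first exact: catH.
  apply: mem_derivedS; first exact: (gcat t1 _ _ (cat1 _ _)).
  exact: (gcat t2 _ _ (cat2 _ _)).
split.
- exists [::] => //.
  exact: (subgroup1 (derived_subgroup n.+1 (generated_subgroup _))).
- move=> y z [t1 Ht1 Dy] [t2 Ht2 Dz]; exists (t1 ++ t2); first exact: catH.
  apply: (subgroupM (derived_subgroup n.+1 (generated_subgroup _))).
    exact: (gcat t1 _ _ (cat1 _ _)).
  exact: (gcat t2 _ _ (cat2 _ _)).
- move=> y [t Ht Dy]; exists t => //.
  exact: (subgroupV (derived_subgroup n.+1 (generated_subgroup _))).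
Qed.

Lemma subnormal_derived H K n : is_subnormal H K -> is_subnormal (derived H n) K.
Proof.
move=> nHK; elim: n => // n [sHn sK [r [N [N0 Nr nN]]]].
have sHn1 : is_subgroup (derived H n.+1) by apply: generated_subgroup.
split=> //; exists r.+1, (fun k => if k is j.+1 then N j else derived H n.+1).
split=> // -[_|k /nN //]; rewrite N0; split=> //.
  by have := @derived_subS (derived H n) 0 sHn.
move=> x y Hx Hy; apply: (@derivedJ (derived H n) 1) => // z Hz.
exact: subgroupJ.
Qed.

Lemma subnormal_setIT H K :
  is_subnormal H [set: gT] -> is_subgroup K -> is_subnormal (H `&` K) K.
Proof.
move=> [sH _ [r [N [N0 Nr nN]]]] sK.
split=> //; first exact: subgroupI.
exists r, (fun k => N k `&` K); rewrite N0 Nr setTI; split=> // k /nN[sN sN' sub nor].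
split=> [||x [/sub ? ?] //|x y [Nx Kx] [Ny Ky]]; [exact: subgroupI|exact: subgroupI|].
by split; [apply: nor|apply: subgroupJ].
Qed.

Definition engel a n x := iter n (fun z => [~ z, a]) x.

(** Each commutator with [a] goes one step down the chain: [[~ z, a]] is the conjugate of [a^-1] by
    [z] times [a], and both factors lie in the next smaller term. *)
Lemma engel_chain (N : nat -> set gT) r a k x :
  (forall j, j < r -> is_normal (N j) (N j.+1)) -> N 0 a -> N r x -> k <= r ->
  N (r - k) (engel a k x).
Proof.
move=> nN Na Nx.
have Nja j : j <= r -> N j a.
  by elim: j => // j IHj ltjr; have [_ _ sub _] := nN _ ltjr; apply/sub/IHj/ltnW.
elim: k => [|k IHk] lekr; first by rewrite subn0.
have ltkr : r - k.+1 < r by rewrite ltn_subrL (leq_ltn_trans _ lekr).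
have [sN _ _ nor] := nN _ ltkr.
rewrite /engel iterS -/(engel a k x) commgEr; apply: (subgroupM sN); last exact/Nja/ltnW.
apply: nor; first exact/(subgroupV sN)/Nja/ltnW.
by rewrite subnSK //; apply/IHk/ltnW.
Qed.

(* If [c = [v, a]] is fixed by a then [v ^ (a ^+ n) = v * c ^+ n], so c has order
   dividing n. *)
Lemma engel2_expg a v n :
  commute v [~ v, a] -> [~ [~ v, a], a] = 1 -> v ^ (a ^+ n) = v ->
  [~ v ^+ n, a] = 1.
Proof.
set c := [~ v, a] => cvc ca1 van.
have ca : c ^ a = c by apply/conjg_fixP; rewrite ca1.
have va : v ^ a = v * c by rewrite /c commgEl mulVKg.
have vk k : v ^ (a ^+ k) = v * c ^+ k.
  elim: k => [|k IHk]; first by rewrite expg0 conjg1 mulg1.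
  by rewrite expgSr conjgM IHk conjMg conjXg ca va -mulgA -expgS.
have cn1 : c ^+ n = 1 by apply: (mulgI v); rewrite -vk mulg1.
by apply/eqP; rewrite -conjg_fix conjXg va expgMn // cn1 mulg1.
Qed.

(** On the abelian group [B], commutation with [a] is an endomorphism, so it commutes with powers.
    By [engel2_expg] an [n]-th power saves one commutator; doing this [s] times gives the exponent
    [n ^ s]. *)
Lemma engel_expg_fix B a n s u :
  is_subgroup B -> (forall x y, B x -> B y -> commute x y) ->
  (forall x, B x -> B (x ^ a)) -> (forall x, B x -> x ^ (a ^+ n) = x) ->
  B u -> engel a s.+1 u = 1 -> [~ u ^+ (n ^ s), a] = 1.
Proof.
move=> sB cB nB fixB; have TB x : B x -> B [~ x, a].
  by move=> Bx; rewrite commgEl; apply: (subgroupM sB); [apply: (subgroupV sB)|apply: nB].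
have eB k x : B x -> B (engel a k x).
  by move=> Bx; elim: k => // k IHk; rewrite /engel iterS; apply: TB.
have TX k x : B x -> [~ x ^+ k, a] = [~ x, a] ^+ k.
  move=> Bx; have cxa : commute x^-1 (x ^ a).
    by apply: cB; [apply: (subgroupV sB)|apply: nB].
  by rewrite !commgEl conjXg -expVgn -expgMn.
have eX i k x : B x -> engel a i (x ^+ k) = engel a i x ^+ k.
  move=> Bx; elim: i => // i IHi.
  by rewrite /engel !iterS -!/(engel a i _) IHi TX //; apply: eB.
elim: s u => [|s IHs] u Bu eu1; first by rewrite expn0 expg1.
rewrite expnS expgnA; apply: IHs; first exact: (subgroupX _ sB).
rewrite /engel iterS -/(engel a s _) eX //.
have Bv := eB s u Bu.
by apply: engel2_expg => //; [apply/cB/TB|apply: fixB].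
Qed.

(* K acts by conjugation on the classes of O, represented by xs.  The images of the
   derived subgroups in the finite set of (partial) self-maps of xs decrease
   strictly until they stabilize, and they become trivial since K is solvable. *)
Lemma solvable_orbit K (O : set gT) (eqv : gT -> gT -> Prop) (xs : seq gT) m :
  is_subgroup K -> is_solvable K ->
  (forall x g, O x -> K g -> O (x ^ g)) ->
  (forall x y, eqv x y -> eqv y x) ->
  (forall x y z, eqv x y -> eqv y z -> eqv x z) ->
  (forall x y g, O x -> O y -> K g -> eqv x y -> eqv (x ^ g) (y ^ g)) ->
  (forall x, x \in xs -> O x) ->
  (forall x, O x -> exists2 y, y \in xs & eqv x y) ->
  (size xs).+1 ^ size xs <= m ->
  forall g x, derived K m g -> O x -> eqv (x ^ g) x.
Proof.
move=> sK [l Kl] OJ eqC eqT eqJ xsO Oxs lem.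
have sKn n : derived K n `<=` K by apply: derived_sub.
have sD n : is_subgroup (derived K n) by apply: derived_subgroup.
pose R g h := forall x, O x -> eqv (x ^ g) (x ^ h).
have RC g h : R g h -> R h g by move=> Rgh x Ox; apply/eqC/Rgh.
have RT g h k : R g h -> R h k -> R g k.
  by move=> Rgh Rhk x Ox; apply: (eqT) (Rgh x Ox) (Rhk x Ox).
have RM g g' h h' : K g -> K g' -> K h -> K h' ->
    R g g' -> R h h' -> R (g * h) (g' * h').
  move=> Kg Kg' Kh Kh' Rg Rh x Ox; rewrite !conjgM.
  apply: (eqT _ _ _ (Rh _ (OJ _ _ Ox Kg)) _).
  by apply: (eqJ) => //; [apply: (OJ)|apply: (OJ)|apply: Rg].
have RV g g' : K g -> K g' -> R g g' -> R g^-1 g'^-1.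
  move=> Kg Kg' Rg x Ox; have Kg'V := subgroupV sK Kg'.
  have Oy : O (x ^ g^-1) by apply: (OJ) => //; apply: subgroupV.
  have := eqJ _ _ g'^-1 (OJ _ _ Oy Kg) (OJ _ _ Oy Kg') Kg'V (Rg _ Oy).
  by rewrite conjgKV conjgK => /eqC.
have RR g g' h h' : K g -> K g' -> K h -> K h' ->
    R g g' -> R h h' -> R [~ g, h] [~ g', h'].
  move=> Kg Kg' Kh Kh' Rg Rh; rewrite !commgEl !conjgE.
  have [Vg Vg'] := (subgroupV sK Kg, subgroupV sK Kg').
  have [Vh Vh'] := (subgroupV sK Kh, subgroupV sK Kh').
  have [Kgh Kgh'] := (subgroupM sK Kg Kh, subgroupM sK Kg' Kh').
  have [Kvgh Kvgh'] := (subgroupM sK Vh Kgh, subgroupM sK Vh' Kgh').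
  by apply: (RM) => //; [apply: (RV)|apply: (RM) => //; [apply: (RV)|apply: (RM)]].
pose T := {ffun 'I_(size xs) -> option 'I_(size xs)}.
pose x_ (i : 'I_(size xs)) := tnth (in_tuple xs) i.
have x_O i : O (x_ i) by apply/xsO/mem_tnth.
have Ox_ x : O x -> exists i, eqv x (x_ i).
  by move=> /Oxs[y /(tnthP (in_tuple xs))[i ->] exi]; exists i.
(* For [g] in [K], the finite code [phi g] determines [g] modulo [R]. Equivalent elements get the
   same pick, so [phi] is constant on the classes of [R]. *)
pose phi g : T := [ffun i => [pick j | `[< eqv (x_ i ^ g) (x_ j) >]]].
have phiR g h : K g -> K h -> phi g = phi h -> R g h.
  move=> Kg Kh /ffunP egh x Ox; have [i xi] := Ox_ x Ox.
  have : eqv (x_ i ^ g) (x_ i ^ h).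
    have := egh i; rewrite !ffunE; case: pickP => [j /asboolP gj|no _]; last first.
      by have [j /asboolP] := Ox_ _ (OJ _ _ (x_O i) Kg); rewrite no.
    by case: pickP => // k /asboolP hk [ejk]; apply: (eqT _ _ _ gj _); rewrite ejk; apply: (eqC).
  move=> egh'; apply: (eqT _ _ _ (eqJ _ _ _ Ox (x_O i) Kg xi) _).
  exact/(eqT _ _ _ egh')/eqC/eqJ.
have Rphi g h : R g h -> phi g = phi h.
  move=> Rgh; apply/ffunP=> i; rewrite !ffunE; apply: eq_pick => j.
  by apply/asbool_equiv_eq; split; apply: (eqT); [apply/eqC|]; apply: Rgh.
pose P n : {set T} := finset (fun f => `[< exists2 g, derived K n g & phi g = f >]).
have inP n f : (f \in P n) <-> exists2 g, derived K n g & phi g = f.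
  by rewrite /P inE; split=> /asboolP.
have P1 n : phi 1 \in P n by apply/inP; exists 1 => //; apply: subgroup1.
have PS n : P n.+1 \subset P n.
  apply/fintype.subsetP => f /inP[g /(derived_subS sK) Dg <-]; apply/inP; by exists g.
(* The image of a derived subgroup modulo [R] determines the next image, because [R] is compatible
   with commutators. *)
have stab n : P n = P n.+1 -> P n.+1 = P n.+2.
  move=> eP; apply/eqP; rewrite finset.eqEsubset PS andbT.
  apply/fintype.subsetP => f /inP[g Dg <-]; apply/inP.
  suff [_ [h Dh Rgh]] : K g /\ exists2 h, derived K n.+2 h & R g h.
    by exists h => //; apply/esym/Rphi.
  pose Q := [set g | K g /\ exists2 h, derived K n.+2 h & R g h].
  apply: (@commutator_subset (derived K n) (derived K n) Q) Dg.
    split=> [|x y [Kx [x' Dx' Rx]] [Ky [y' Dy' Ry]]|x [Kx [x' Dx' Rx]]].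
    - split; first exact: subgroup1.
      exists 1; first exact: (subgroup1 (sD n.+2)).
      move=> z Oz; rewrite conjg1; have [y _ zy] := Oxs z Oz.
      by apply: (eqT) zy (eqC _ _ zy).
    - split; first exact: subgroupM.
      exists (x' * y'); first exact: (subgroupM (sD n.+2)).
      by apply: (RM) => //; apply: (sKn n.+2).
    - split; first exact: subgroupV.
      exists x'^-1; first exact: (subgroupV (sD n.+2)).
      by apply: (RV) => //; apply: (sKn n.+2).
  have key x : derived K n x -> exists2 x', derived K n.+1 x' & R x x'.
    move=> Dx; have /inP[x' Dx' ex'] : phi x \in P n.+1 by rewrite -eP; apply/inP; exists x.
    by exists x' => //; apply: phiR => //; [apply: (sKn n)|apply: (sKn n.+1)].
  move=> x y Dx Dy; have [[x' Dx' Rx] [y' Dy' Ry]] := (key x Dx, key y Dy).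
  split; first by apply: subgroupR => //; apply: (sKn n).
  exists [~ x', y']; first exact: mem_derivedS.
  by apply: RR => //; do ?[exact: (sKn n)|exact: (sKn n.+1)].
(* While the images shrink, each step loses at least one of the [#|T|] codes, and [#|T|] is
   [(size xs).+1 ^ size xs]. *)
have small n : #|P n| + n <= #|T| \/ P n = P n.+1.
  elim: n => [|n [IHn|/stab]]; [by left; rewrite addn0 max_card| |by right].
  have [/eqP/stab|nPS] := boolP (P n == P n.+1); first by right.
  left; rewrite addnS -addSn; apply: leq_trans IHn; rewrite leq_add2r.
  by apply: proper_card; rewrite finset.properEneq eq_sym nPS PS.
have cardT : #|T| <= m by rewrite card_ffun card_option card_ord.
have Pm : P m = P m.+1.
  case: (small m) => // lem'; have := leq_trans lem' cardT.
  rewrite -[leqRHS]add0n leq_add2r leqn0 => /eqP/cards0_eq P0.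
  by have := P1 m; rewrite P0 inE.
have Pmk k : P (m + k) = P (m + k).+1.
  by elim: k => [|k IHk]; rewrite ?addn0 // addnS; apply: stab.
have Pml : P m = P (m + l).
  by elim: {+}l => [|k IHk]; rewrite ?addn0 // addnS IHk Pmk.
move=> g x Dg Ox; have : phi g \in P m by apply/inP; exists g.
rewrite Pml => /inP[h /(derived_le sK (leq_addl m l))]; rewrite Kl => -> e1g.
by have := phiR _ _ (subgroup1 sK) (sKn _ _ Dg) e1g x Ox; rewrite conjg1 => /eqC.
Qed.

End Subgroups.

(** * Finite subrings of division rings *)

Section FiniteSubring.
Local Open Scope ring_scope.
Variables (D : unitRingType) (s : seq D).
Hypotheses (hD : is_division_ring D) (s1 : 1 \in s)
  (sB : {in s &, forall x y, x - y \in s}) (sM : {in s &, forall x y, x * y \in s}).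

Definition subring_of_seq : {pred D} := fun x => x \in s.
Local Notation P := subring_of_seq.

(** Left multiplication by a nonzero [y] is an injection of the finite set [s] into itself, so it
    reaches 1. *)
Lemma divring_closed_subring_of_seq : GRing.divring_closed P.
Proof.
split=> // x y xs ys.
have [->|y0] := eqVneq y 0; first by rewrite invr0 mulr0 -(subrr x); apply: (sB xs xs).
suff vs: y^-1 \in s by exact: (sM xs vs).
have sub : {subset map ( *%R y) (undup s) <= undup s}.
  by move=> _ /mapP[z zs ->]; rewrite mem_undup sM // -mem_undup.
have uy : uniq (map ( *%R y) (undup s)).
  by rewrite map_inj_uniq ?undup_uniq //; apply: mulrI; apply: hD.
have [|_ /(_ 1)] := uniq_min_size uy sub; first by rewrite size_map.
rewrite mem_undup s1 => /mapP[z]; rewrite mem_undup => zs e1.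
suff -> : y^-1 = z by [].
by apply: (mulrI (hD y0)); rewrite divrr ?hD.
Qed.
HB.instance Definition _ := GRing.isDivringClosed.Build D P divring_closed_subring_of_seq.

Definition subring_of_seq_type := {x : D | x \in P}.
Local Notation sT := subring_of_seq_type.
HB.instance Definition _ := SubChoice.on sT.
HB.instance Definition _ := [SubChoice_isSubUnitRing of sT by <:].
Definition to_seq_sub (x : sT) : seq_sub s := SeqSub (valP x).
Definition of_seq_sub (x : seq_sub s) : sT := Sub (ssval x) (ssvalP x).
Lemma to_seq_subK : cancel to_seq_sub of_seq_sub. Proof. by move=> x; apply/val_inj. Qed.
HB.instance Definition _ : isCountable sT := CanIsCountable to_seq_subK.
HB.instance Definition _ : isFinite sT := CanIsFinite to_seq_subK.
Lemma finite_subring_commute : {in s &, commutative (@GRing.mul D)}.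
Proof.
move=> x y xs ys; have domT : GRing.integral_domain_axiom sT.
  move=> u v /(congr1 val) uv0; have {uv0} : val u * val v = 0 by [].
  have [-> //|u0] := eqVneq u 0; have uu : val u \is a GRing.unit.
    by apply: hD; apply: contraNneq u0 => u0; apply/eqP/val_inj.
  by rewrite -(mulr0 (val u)) => /(mulrI uu) v0; apply/orP; right; apply/eqP/val_inj.
have := finDomain_mulrC domT (Sub x xs) (Sub y ys).
by move/(congr1 val).
Qed.

End FiniteSubring.

Section UnitGroup.
Local Open Scope ring_scope.
Variable D : unitRingType.
Implicit Types (u v w a b c : units D) (n m : nat).

Lemma val_unitsM u v : val (u * v)%g = val u * val v. Proof. by []. Qed.

Lemma val_unitsX u n : val (u ^+ n)%g = val u ^+ n.
Proof. by elim: n => // n IHn; rewrite expgS val_unitsM IHn exprS. Qed.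

Lemma commute_unitsP u v : commute u v <-> GRing.comm (val u) (val v).
Proof. by split=> [/(congr1 val)|cuv] //; apply/val_inj. Qed.

Lemma val_units_neq0 u : val u != 0.
Proof. by apply: contraTneq (valP u) => ->; rewrite unitr0. Qed.

(** As [p] is 0 in [D], the integral combinations of [M] form a finite subring, and
    [finite_subring_commute] applies. *)
Lemma finite_unit_group_commute (hD : is_division_ring D) (M : seq (units D)) p :
  (0 < p)%N -> p%:R = 0 :> D -> 1%g \in M ->
  {in M &, forall u v, (u * v)%g \in M} -> {in M &, forall u v, commute u v}.
Proof.
case: p => // p _ p0 M1 MM.
pose M_ i := val (nth 1%g M i).
pose comb (k : nat -> nat) := \sum_(i < size M) (k i)%:R * M_ i.
pose s := [seq comb (fun i => oapp (fun j => f j : nat) 0%N (insub i)) |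
           f : {ffun 'I_(size M) -> 'I_p.+1}].
have inS x : (x \in s) <-> exists k, x = comb k.
  split=> [/mapP[f _ ->]|[k ->]]; first by eexists.
  apply/mapP; exists [ffun i : 'I_(size M) => inord (k i %% p.+1)%N]; first by rewrite mem_enum.
  apply: eq_bigr => i _; rewrite valK /= ffunE inordK ?ltn_pmod //; congr (_ * _).
  by rewrite {1}(divn_eq (k i) p.+1) natrD natrM p0 mulr0 add0r.
have sD x y : x \in s -> y \in s -> x + y \in s.
  move=> /inS[k ->] /inS[l ->]; apply/inS; exists (fun i => k i + l i)%N.
  by rewrite /comb -big_split /=; apply: eq_bigr => i _; rewrite natrD mulrDl.
have s0 : 0 \in s.
  by apply/inS; exists (fun=> 0%N); rewrite /comb big1 // => i _; rewrite mul0r.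
have sMn x m : x \in s -> m%:R * x \in s.
  by move=> xs; elim: m => [|m IHm]; rewrite ?mul0r // mulrS mulrDl mul1r sD.
have sM_ u : u \in M -> val u \in s.
  move=> uM; apply/inS; exists (fun i => i == index u M : nat).
  have uM' := uM; rewrite -index_mem in uM'.
  rewrite /comb (bigD1 (Ordinal uM')) //= eqxx mul1r /M_ nth_index // big1 ?addr0 // => i.
  by rewrite -val_eqE /= => /negPf->; rewrite mul0r.
have sN x : x \in s -> - x \in s.
  move=> xs; rewrite (_ : - x = p%:R * x) ?sMn //.
  by apply/eqP; rewrite eq_sym -addr_eq0 -[X in _ + X]mul1r -mulrDl -mulrSr p0 mul0r.
have sM x y : x \in s -> y \in s -> x * y \in s.
  move=> /inS[k ->] /inS[l ->]; rewrite /comb mulr_suml.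
  apply: (big_ind (fun x => x \in s)) => // i _; rewrite mulr_sumr.
  apply: (big_ind (fun x => x \in s)) => // j _.
  rewrite -mulrA (mulrA (M_ i)) (commr_nat (M_ i)) -mulrA; apply/sMn/sMn.
  by apply: (sM_ (nth 1%g M i * nth 1%g M j)%g); apply: MM; rewrite mem_nth.
have sB : {in s &, forall x y, x - y \in s} by move=> x y xs /sN; apply: sD.
move=> u v uM vM; apply/commute_unitsP.
by apply: (finite_subring_commute hD (sM_ _ M1) sB sM); apply: sM_.
Qed.

Lemma conjX_commuting_commutator b a n :
  commute [~ b, a]%g a -> commute [~ b, a]%g b -> (b ^ (a ^+ n) = b * [~ b, a] ^+ n)%g.
Proof.
set c := [~ b, a]%g => ca cb.
have cac : (c ^ a = c)%g by apply/conjg_fixP/commgP.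
elim: n => [|n IHn]; first by rewrite !expg0 conjg1 mulg1.
by rewrite expgSr conjgM IHn conjMg conjXg cac expgS mulgA /c commgEl mulVKg.
Qed.

Lemma torsion_commute (hD : is_division_ring D) a b c k l n p :
  c = [~ b, a]%g -> commute c a -> commute c b ->
  (0 < k)%N -> (0 < l)%N -> (0 < n)%N -> (0 < p)%N ->
  (a ^+ k = 1)%g -> (b ^+ l = 1)%g -> (c ^+ n = 1)%g -> p%:R = 0 :> D ->
  commute a b.
Proof.
move=> cE ca cb k0 l0 n0 p0 ak bl cn pD.
pose F i j h := (c ^+ i * a ^+ j * b ^+ h)%g.
pose M := [seq F i jh.1 jh.2 | i <- iota 0 n,
                              jh <- [seq (j, h) | j <- iota 0 k, h <- iota 0 l]].
have inM i j h : F i j h \in M.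
  suff -> : F i j h = F (i %% n)%N (j %% k)%N (h %% l)%N.
    apply: (@allpairs_f _ _ _ (fun i jh => F i jh.1 jh.2) _ _ (i %% n)%N (j %% k, h %% l)%N).
      by rewrite mem_iota ltn_pmod.
    by apply: allpairs_f; rewrite mem_iota ltn_pmod.
  have red x q m : (x ^+ q = 1)%g -> (x ^+ (m %% q) = x ^+ m :> units D)%g.
    by move=> xq; rewrite {2}(divn_eq m q) expgnDr mulnC expgnA xq expg1n mul1g.
  by rewrite /F !red.
have FM i j h i' j' h' : (F i j h * F i' j' h' = F (i + i' + j' * h) (j + j') (h + h'))%g.
  have cXa m q : commute (c ^+ m) (a ^+ q) by apply: commuteX2.
  have cXb m q : commute (c ^+ m) (b ^+ q) by apply: commuteX2.
  have bha : (b ^+ h * a ^+ j' = c ^+ (j' * h) * (a ^+ j' * b ^+ h))%g.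
    rewrite conjgC conjXg conjX_commuting_commutator -?cE // expgMn.
      by rewrite -expgnA mulgA (commuteM (cXa _ _) (cXb _ _)).
    by rewrite -[b in commute b]expg1; apply/commute_sym.
  rewrite /F -3!mulgA [X in (c ^+ i * X)%g]mulgA (mulgA _ (c ^+ i')%g).
  rewrite -(commuteM (cXa _ _) (cXb _ _)) !expgnDr -!mulgA; congr (_ * (_ * _))%g.
  rewrite (mulgA (b ^+ h)%g) bha !mulgA; congr (_ * _ * _)%g.
  by rewrite -cXa.
have MM : {in M &, forall u v, (u * v)%g \in M}.
  move=> u v /allpairsP[[i jh] [_ _ ->]] /allpairsP[[i' jh'] [_ _ ->]] /=.
  by rewrite FM.
have M1 : 1%g \in M by have := inM 0%N 0%N 0%N; rewrite /F !expg0 !mulg1.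
apply: (finite_unit_group_commute hD p0 pD M1 MM).
  by have := inM 0%N 1%N 0%N; rewrite /F !expg0 expg1 mul1g mulg1.
by have := inM 0%N 0%N 1%N; rewrite /F !expg0 expg1 !mul1g.
Qed.

End UnitGroup.

(** * Bounded Engel elements *)

Section DivisionRing.
Local Open Scope ring_scope.
Variables (D : unitRingType) (hD : is_division_ring D).
Implicit Types (u v w a b c : units D) (x y z lam : D) (n m : nat) (U : set (units D)).

Lemma div_mulf_eq0 x y : (x * y == 0) = (x == 0) || (y == 0).
Proof.
have [->|x0] /= := eqVneq x 0; first by rewrite mul0r eqxx.
by rewrite -(inj_eq (mulrI (hD x0)) y) mulr0.
Qed.

Lemma div_expf_eq0 x n : (x ^+ n == 0) = (0 < n)%N && (x == 0).
Proof.
elim: n => [|n IHn]; first by rewrite expr0 oner_eq0.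
by rewrite exprS div_mulf_eq0 IHn; case: (x == 0); rewrite ?andbF.
Qed.

Lemma uniq_roots_comm (rs : seq D) :
  uniq rs -> {in rs &, forall x y, GRing.comm x y} -> uniq_roots rs.
Proof.
elim: rs => //= x rs IHrs /andP[xrs urs] crs; apply/andP; split; last first.
  by apply: IHrs => // y z yr zr; apply: crs; rewrite inE ?yr ?zr orbT.
apply/allP=> y yrs; rewrite /diff_roots crs ?inE ?eqxx ?yrs ?orbT //=.
by apply: hD; rewrite subr_eq0; apply: contraNneq xrs => <-.
Qed.

(** In a noncommutative division ring a nonzero polynomial may have infinitely many roots; the bound
    by the degree survives for roots that commute with one another. *)
Lemma poly_comm_roots_eq0 (p : {poly D}) (x : nat -> D) :
  injective x -> (forall i j, GRing.comm (x i) (x j)) -> (forall i, root p (x i)) ->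
  p = 0.
Proof.
move=> injx cx px; apply/eqP; apply: contraT => p0.
have := @max_ring_poly_roots _ p (mkseq x (size p)) p0.
rewrite size_mkseq ltnn => -> //.
  by apply/allP=> _ /mapP[i _ ->].
apply: uniq_roots_comm; first by rewrite map_inj_uniq ?iota_uniq.
by move=> _ _ /mapP[i _ ->] /mapP[j _ ->].
Qed.

(** Models the unit group of a division subring. Since 0 is not in [units D], closure is asked only
    for sums that are units. *)
Definition unit_subring U :=
  is_subgroup U /\ forall u v w, U u -> U v -> val w = val u + val v -> U w.

(* If conjugation by a maps x to lam * x and fixes lam, then the j-fold commutator
   of 1 + x with a is a quotient of two products of factors 1 + lam ^+ k * x; the
   exponents k are listed by [engel_exps j] below, and 0 occurs in exactly one of
   the two lists. *)
Definition linfacs lam (l : seq nat) x := \prod_(k <- l) (1 + lam ^+ k * x).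
Definition linfacs_poly lam (l : seq nat) : {poly D} :=
  \prod_(k <- l) (1 + (lam ^+ k)%:P * 'X).

Lemma linfacs_comm lam l x y :
  GRing.comm y lam -> GRing.comm y x -> GRing.comm y (linfacs lam l x).
Proof.
move=> yl yx; apply: commr_prod => k _; apply: commrD; first exact: commr1.
by apply: commrM => //; apply: commrX.
Qed.

Lemma linfacs_polyE lam l x :
  GRing.comm x lam -> (linfacs_poly lam l).[x] = linfacs lam l x.
Proof.
move=> xl; rewrite /linfacs_poly /linfacs; elim: l => [|k l IHl].
  by rewrite !big_nil hornerC.
rewrite !big_cons hornerM_comm.
  by congr (_ * _); rewrite // hornerD hornerC hornerMX hornerC.
have IHl' : (linfacs_poly lam l).[x] = linfacs lam l x by exact: IHl.
rewrite /comm_poly [_.[x]]IHl'; exact: (linfacs_comm l xl (erefl (x * x))).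
Qed.

Lemma linfacs_cat lam l1 l2 x :
  linfacs lam (l1 ++ l2) x = linfacs lam l1 x * linfacs lam l2 x.
Proof. exact: big_cat. Qed.

Lemma linfacsC lam l1 l2 x : GRing.comm x lam ->
  GRing.comm (linfacs lam l1 x) (linfacs lam l2 x).
Proof.
move=> xl; apply: linfacs_comm; apply/commr_sym/linfacs_comm => //; exact/commr_sym.
Qed.

Lemma linfacs_conj a lam l x :
  GRing.comm x lam -> GRing.comm (val a) lam -> (val a)^-1 * x * val a = lam * x ->
  (val a)^-1 * linfacs lam l x * val a = linfacs lam (map S l) x.
Proof.
move=> xl al ax; have Ua := valP a; rewrite /linfacs; elim: l => [|k l IHl].
  by rewrite !big_nil mulr1 mulVr.
rewrite !big_cons -IHl mulrA.
have -> : (val a)^-1 * (1 + lam ^+ k * x) = (1 + lam ^+ k.+1 * x) * (val a)^-1.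
  rewrite mulrDr mulrDl mulr1 mul1r mulrA (commrX k (commr_sym (commrV (commr_sym al)))) -mulrA.
  congr (_ + _); rewrite exprSr -!mulrA; congr (_ * _).
  by apply: (mulIr Ua); rewrite ax -!mulrA mulVr ?mulr1.
by rewrite !mulrA.
Qed.

Fixpoint engel_exps j : seq nat * seq nat :=
  if j is i.+1 then
    let lm := engel_exps i in (map S lm.1 ++ lm.2, map S lm.2 ++ lm.1)
  else ([:: 0%N], [::]).

(** If [v] is a quotient [L / M], then [v ^ a] is the quotient [L' / M'] for the shifted lists, and
    [[~ v, a] = v^-1 * v ^ a] is [(L' M) / (M' L)]. The denominator is multiplied out so that
    [v = 1] becomes a polynomial identity in [x]. *)
Lemma engel_linfacs a w x lam j :
  GRing.comm x lam -> GRing.comm (val a) lam -> (val a)^-1 * x * val a = lam * x ->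
  val w = 1 + x ->
  val (engel a j w) * linfacs lam (engel_exps j).2 x = linfacs lam (engel_exps j).1 x.
Proof.
move=> xl al ax wx; elim: j => [|j IHj].
  by rewrite /linfacs /= big_nil big_cons big_nil expr0 mul1r !mulr1.
set l := (engel_exps j).1 in IHj; set m := (engel_exps j).2 in IHj.
rewrite -[(engel_exps j.+1).1]/(map S l ++ m) -[(engel_exps j.+1).2]/(map S m ++ l).
rewrite -[engel a j.+1 w]/[~ engel a j w, a]%g.
set v := engel a j w in IHj *; have Uv := valP v; have Ua := valP a.
have -> : val [~ v, a]%g = (val v)^-1 * ((val a)^-1 * val v * val a) by rewrite /= !mulrA.
have LC l1 l2 := @linfacsC lam l1 l2 x xl.
have conjE := linfacs_conj _ xl al ax.
have svE : (val a)^-1 * val v * val a * linfacs lam (map S m) x = linfacs lam (map S l) x.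
  rewrite -!conjE -IHj !mulrA; congr (_ * _ * _).
  by rewrite -(mulrA _ (val a)) divrr ?mulr1.
rewrite !linfacs_cat -mulrA (mulrA _ _ (linfacs _ l x)) svE -(LC l) -IHj !mulrA mulVr // mul1r.
exact: LC.
Qed.

Lemma engel_exps0 j : (0%N \in (engel_exps j).1) = (0%N \notin (engel_exps j).2).
Proof.
have mapS0 (l : seq nat) : 0%N \in map S l = false by apply/negbTE/mapP => -[].
by elim: j => //= j IHj; rewrite !mem_cat !mapS0 /= IHj negbK.
Qed.

(** At -1 the factor of index [k] is [1 - lam ^+ k], which vanishes only for [k = 0]. *)
Lemma linfacsN1_eq0 lam l : (forall k, (0 < k)%N -> lam ^+ k != 1) ->
  (linfacs lam l (-1) == 0) = (0%N \in l).
Proof.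
move=> laminf; rewrite /linfacs; elim: l => [|k l IHl].
  by rewrite big_nil oner_eq0.
rewrite big_cons div_mulf_eq0 IHl inE mulrN1 subr_eq0; congr (_ || _).
by case: k => [|k]; rewrite ?expr0 ?eqxx // eq_sym (negPf (laminf _ _)).
Qed.

Lemma expg_inj_inforder u : (forall k, (0 < k)%N -> (u ^+ k)%g <> 1%g) ->
  injective (fun i => u ^+ i)%g.
Proof.
move=> uinf; suff lem i j : (i <= j)%N -> (u ^+ i = u ^+ j)%g -> i = j.
  move=> i j eij; case/orP: (leq_total i j) => leij; first exact: lem.
  by apply/esym/lem.
move=> leij; rewrite -(subnKC leij) expgnDr -{1}[(u ^+ i)%g]mulg1 => /mulgI/esym e.
case: (posnP (j - i)) => [->|/uinf //]; by rewrite addn0.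
Qed.

(** * Identities in [1 + f * b] when [[~ b, a]] commutes with [a] and [b] *)

Section CentralCommutator.
Variables (U : set (units D)) (a b : units D) (s : nat).
Hypothesis U_subring : unit_subring U.
Let c := [~ b, a]%g.
Hypotheses (Ub : U b) (ca : commute c a) (cb : commute c b) (c_neq1 : c <> 1%g).
Hypothesis engelU : forall u, U u -> engel a s u = 1%g.

Let sU : is_subgroup U := U_subring.1.

Let bJa : (b ^ a = c * b)%g.
Proof. by rewrite cb /c commgEl mulVKg. Qed.

Variable f : units D.
Hypotheses (Uf : U f) (fa : commute f a) (fb : commute f b).
Let x := val (f * b)%g.

Let fc : commute f c.
Proof. by rewrite /c commgEl conjgE; do ?[apply: commuteM|apply: commuteV]. Qed.

Let xc : GRing.comm x (val c).
Proof. by apply/commute_unitsP/commute_sym/commuteM => //; apply: commute_sym. Qed.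

Let xJa : (val a)^-1 * x * val a = val c * x.
Proof.
have : ((f * b) ^ a = c * (f * b))%g.
  have fJa : (f ^ a = f)%g by rewrite conjgE fa mulKg.
  by rewrite conjMg bJa fJa (mulgA c) -fc (mulgA f).
by move/(congr1 val); rewrite conjgE mulgA.
Qed.

(** If [1 + x] were 0, then [f * b] would be -1 and commute with [a]; as [f] does too, so would [b],
    against [c_neq1]. *)
Lemma one_plus_unit : exists2 w, U w & val w = 1 + x.
Proof.
have nz : 1 + x != 0.
  apply/eqP=> x1; apply: c_neq1; apply/eqP/commgP.
  have: commute (f * b)%g a.
    apply/commute_unitsP; rewrite -/x -[x](addKr 1) x1 addr0.
    by apply/commr_sym/commrN/commr1.
  move=> cfba; rewrite -[b](mulKg f); apply/commute_sym/commuteM; apply/commute_sym => //.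
  by apply/commute_sym/commuteV/commute_sym.
exists (Units (hD nz)) => //; apply: (U_subring.2 1%g (f * b)%g) => //.
  exact: subgroup1.
exact: subgroupM.
Qed.

Lemma engel_linfacs_eq :
  linfacs (val c) (engel_exps s).2 x = linfacs (val c) (engel_exps s).1 x.
Proof.
have [w Uw wx] := one_plus_unit.
have := engel_linfacs s xc _ xJa wx; rewrite engelU // mul1r; apply.
exact/commute_unitsP/commute_sym.
Qed.

(** When [c ^+ n = 1], [a ^+ n] commutes with [b]. Then [engel_expg_fix], in an abelian group
    containing [1 + x], shows that [(1 + x) ^+ (n ^ s)] commutes with [a]; conjugating it by [a]
    gives the identity. *)
Lemma engel_exp_eq n : (c ^+ n = 1)%g ->
  (1 + val c * x) ^+ (n ^ s) = (1 + x) ^+ (n ^ s).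
Proof.
move=> cn1; have [w Uw wx] := one_plus_unit.
pose C := [set z : units D | [/\ commute z f, commute z b & commute z c]]%classic.
(* [B] is the double centralizer of [f], [b] and [c]. It is abelian because [C] contains these
   three, and stable under [a], which fixes [f] and [c] and sends [b] to [c * b]. *)
pose B := [set u : units D | forall z : units D, C z -> commute z u]%classic.
have Cb : C b by split=> //; apply: commute_sym.
have Cf : C f by split.
have Cc : C c by split=> //; apply: commute_sym.
have BC u : B u -> C u by move=> Bu; split; apply: commute_sym; apply: Bu.
have comm_conj (z u v : units D) : commute z (u ^ v)%g -> commute (z ^ v^-1)%g u.
  by rewrite /commute => e; apply: (conjg_inj v); rewrite (conjMg (_ ^ _)) (conjMg u) conjgKV.
have cJ (z : units D) : commute z a -> (z ^ a = z)%g.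
  by move=> za; apply/conjg_fixP/commgP.
have BJ u : B u -> B (u ^ a)%g.
  move=> Bu z [zf zb zc]; rewrite /commute; apply: (conjg_inj a^-1%g).
  rewrite (conjMg z) (conjMg (u ^ a)) conjgK; apply: Bu; split; apply: comm_conj.
  - by rewrite (cJ f).
  - by rewrite bJa; apply: commuteM.
  - by rewrite (cJ c).
have aC : C (a ^+ n)%g.
  split; try by apply/commute_sym/commuteX.
  have := conjX_commuting_commutator n ca cb; rewrite -/c cn1 mulg1 => /conjg_fixP/commgP.
  exact: commute_sym.
have Bw : B w.
  move=> z [zf zb zc]; apply/commute_unitsP; rewrite wx; apply: commrD; first exact: commr1.
  by apply/(commute_unitsP z (f * b)%g)/commuteM.
have : [~ w ^+ (n ^ s), a]%g = 1%g.
  apply: (@engel_expg_fix _ B a n s w (subgroup_centralizer C) _ BJ _ Bw).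
  - by move=> u v Bu Bv; apply: Bv; apply: BC.
  - by move=> u Bu; apply/conjg_fixP/commgP/commute_sym/Bu.
  - by rewrite -[engel _ _ _]/[~ engel a s w, a]%g engelU // comm1g.
move=> /eqP/commgP/(congr1 val); rewrite !val_unitsM val_unitsX wx => cMa.
have Ua' := valP a; have conj1x : (val a)^-1 * (1 + x) * val a = 1 + val c * x.
  by rewrite mulrDr mulrDl mulr1 mulVr // xJa.
have conjX k y : (val a)^-1 * y ^+ k * val a = ((val a)^-1 * y * val a) ^+ k.
  elim: k => [|k IHk]; first by rewrite !expr0 mulr1 mulVr.
  by rewrite !exprS -IHk !mulrA mulrK.
by rewrite -conj1x -conjX -mulrA cMa mulKr.
Qed.

End CentralCommutator.

Lemma engel_central_commutator_eq1 U a b s :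
  unit_subring U -> U a -> U b ->
  commute [~ b, a]%g a -> commute [~ b, a]%g b ->
  (forall u, U u -> engel a s u = 1%g) -> [~ b, a]%g = 1%g.
Proof.
set c := [~ b, a]%g => Usub Ua Ub ca cb engelU; apply: contrapT => c1.
have sU := Usub.1.
have cX i : commute (c ^+ i)%g a /\ commute (c ^+ i)%g b.
  by split; apply/commute_sym/commuteX/commute_sym.
have Uc i : U (c ^+ i)%g by apply/(subgroupX _ sU)/(subgroupR sU).
have val_inj_b (F : nat -> units D) : injective F -> injective (fun i => val (F i * b)%g).
  by move=> injF i j /val_inj/mulIg/injF.
have [[n [n0 cn1]]|cinf] := pselect (exists n, (0 < n)%N /\ (c ^+ n = 1)%g); last first.
  have {}cinf k : (0 < k)%N -> (c ^+ k)%g <> 1%g by move=> k0 ck; apply: cinf; exists k.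
  (* Infinite order: the powers of [c] serve as [f]. The two sides of [engel_linfacs_eq] then agree
     as polynomials, yet exactly one of them vanishes at -1. *)
  pose l := engel_exps s; pose p := linfacs_poly (val c) l.1 - linfacs_poly (val c) l.2.
  have p0 : p = 0.
    apply: (poly_comm_roots_eq0 (val_inj_b _ (expg_inj_inforder cinf))) => i.
      move=> j; apply/commute_unitsP; apply: commuteM; apply/commute_sym/commuteM.
      - exact: commuteX2.
      - exact: (cX j).2.
      - exact: commute_sym (cX i).2.
      - by [].
    have xc : GRing.comm (val (c ^+ i * b)%g) (val c).
      by apply/commute_unitsP/commute_sym/commuteM => //; apply: commuteX.
    rewrite /root hornerD hornerN !linfacs_polyE // subr_eq0 eq_sym.
    by apply/eqP/(engel_linfacs_eq Usub Ub ca cb c1 engelU (Uc i) (cX i).1 (cX i).2).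
  have comN1 : GRing.comm (-1) (val c) by apply/commr_sym/commrN/commr1.
  have := congr1 (fun q : {poly D} => q.[-1]) p0.
  rewrite hornerD hornerN horner0 !linfacs_polyE // => /subr0_eq e.
  have cinf' k : (0 < k)%N -> val c ^+ k != 1.
    by move=> /cinf ck; apply/eqP=> ck'; apply: ck; apply: val_inj; rewrite val_unitsX.
  have := linfacsN1_eq0 l.1 cinf'; rewrite e (linfacsN1_eq0 l.2 cinf') engel_exps0.
  by case: (_ \in _).
(* Finite order: an infinite commuting family in [U] that centralizes [a] and [b] turns
   [engel_exp_eq] into a polynomial identity, whose value at -1 gives [(1 - c) ^+ M = 0]. *)
have no_seq (F : nat -> units D) : injective F -> (forall i, U (F i)) ->
    (forall i, commute (F i) a) -> (forall i, commute (F i) b) ->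
    (forall i j, commute (F i) (F j)) -> False.
  move=> injF UF Fa Fb FF; apply: (c1); pose M := (n ^ s)%N.
  have M0 : (0 < M)%N by rewrite expn_gt0 n0.
  pose p : {poly D} := (1 + (val c)%:P * 'X) ^+ M - (1 + 'X) ^+ M.
  have evalp y : GRing.comm y (val c) -> p.[y] = (1 + val c * y) ^+ M - (1 + y) ^+ M.
    move=> yc; rewrite hornerD hornerN !horner_exp_comm.
    - by rewrite !hornerD !hornerC hornerMX hornerX hornerC.
    - by rewrite /comm_poly hornerD hornerC hornerX mulrDl mulrDr mul1r mulr1.
    - rewrite /comm_poly hornerD hornerMX !hornerC mulrDl mulrDr mul1r mulr1.
      by rewrite mulrA yc.
  have p0 : p = 0.
    apply: (poly_comm_roots_eq0 (val_inj_b _ injF)) => i.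
      move=> j; apply/commute_unitsP; apply: commuteM; apply/commute_sym/commuteM => //.
      exact: commute_sym.
    rewrite /root evalp.
      by rewrite subr_eq0; apply/eqP/(engel_exp_eq Usub Ub ca cb c1 engelU).
    apply/commute_unitsP/commute_sym/commuteM => //; rewrite /c commgEl conjgE.
    by apply: commute_sym; do ?[apply: commuteM|apply: commuteV].
  have := evalp (-1) (commr_sym (commrN (commr1 _))).
  rewrite p0 horner0 mulrN1 subrr expr0n -[(_ == _)]negbK -lt0n M0 subr0 => /esym/eqP.
  by rewrite div_expf_eq0 M0 subr_eq0 eq_sym => /eqP c1'; apply: val_inj.
have an : commute (a ^+ n)%g b.
  have := conjX_commuting_commutator n ca cb; rewrite -/c cn1 mulg1 => /conjg_fixP/commgP.
  exact: commute_sym.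
have bn : commute (b ^+ n)%g a.
  apply/commgP/conjg_fixP; rewrite conjXg [(b ^ a)%g](_ : _ = b * c)%g.
    by rewrite expgMn ?cn1 ?mulg1.
  by rewrite /c commgEl mulVKg.
(* The powers of [u ^+ n] would form such a family if [u] had infinite order. *)
have inf_seq u : U u -> commute (u ^+ n)%g a -> commute (u ^+ n)%g b ->
    exists k, (0 < k)%N /\ (u ^+ k = 1)%g.
  move=> Uu una unb; apply: contrapT => uinf.
  have uninf k : (0 < k)%N -> (u ^+ n ^+ k)%g <> 1%g.
    by move=> k0; rewrite -expgnA => unk; apply: uinf; exists (n * k)%N; rewrite muln_gt0 n0.
  apply: (no_seq _ (expg_inj_inforder uninf)) => i.
  - exact/(subgroupX _ sU)/(subgroupX _ sU).
  - exact/commute_sym/commuteX/commute_sym.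
  - exact/commute_sym/commuteX/commute_sym.
  - by move=> j; apply: commuteX2.
have [k [k0 ak]] : exists k, (0 < k)%N /\ (a ^+ k = 1)%g.
  by apply: inf_seq => //; apply/commute_sym/commuteX.
have [l [l0 bl]] : exists k, (0 < k)%N /\ (b ^+ k = 1)%g.
  by apply: inf_seq => //; apply/commute_sym/commuteX.
(* In positive characteristic [torsion_commute] concludes; in characteristic 0 the positive integers
   are a family excluded by [no_seq]. *)
have [[q [q0 qD]]|char0] := pselect (exists q, (0 < q)%N /\ q%:R = 0 :> D).
  apply: c1; apply/eqP/commgP/commute_sym.
  exact: (torsion_commute hD (erefl _) ca cb k0 l0 n0 q0 ak bl cn1 qD).
have nz i : i.+1%:R != 0 :> D by apply/eqP=> iD; apply: char0; exists i.+1.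
pose F i := Units (hD (nz i)).
have cF i u : commute (F i) u by apply/commute_unitsP/commr_sym/commr_nat.
apply: (no_seq F) => //; last first.
  elim=> [|i IHi]; first by rewrite (_ : F 0%N = 1%g); [exact: subgroup1|exact: val_inj].
  by apply: (Usub.2 1%g (F i)) => //; exact: subgroup1.
suff lem i j : (i <= j)%N -> F i = F j -> i = j.
  by move=> i j eij; case/orP: (leq_total i j) => /lem; [|move=> /(_ (esym eij))]; auto.
move=> leij /(congr1 val) /= /esym e; have [ltij|] := ltnP i j; last first.
  by move=> leji; apply/anti_leq/andP.
have : (j - i)%:R = 0 :> D by rewrite -subSS natrB // e subrr.
by case: (j - i)%N (subn_gt0 i j) => [|m _ /eqP]; rewrite ?ltij // (negPf (nz m)).
Qed.

End DivisionRing.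

(** * Solvable subnormal subgroups are central *)

Section SolvableSubnormal.
Local Open Scope ring_scope.
Variables (D : unitRingType) (hD : is_division_ring D).
Variable U : set (units D).
Hypothesis Usub : unit_subring U.
Implicit Types (a b g u v w : units D).
Let sU : is_subgroup U := Usub.1.

(** With [w = 1 + u], subtracting [a * u = u * a ^ u] from [a * w = w * a ^ w] gives
    [u * (a ^ u - a ^ w) = a ^ w - a]. Either [u] is a quotient of elements commuting with [a], or
    both conjugates are equal to [a]. *)
Lemma normal_abelian_central (N : set (units D)) :
  is_normal N U -> (forall a b, N a -> N b -> commute a b) ->
  forall a u, N a -> U u -> commute a u.
Proof.
move=> [sN _ sNU nNU] cN a u Na Uu; apply/commute_unitsP.
have [u1|nz] := eqVneq (1 + val u) 0.
  by rewrite -[val u](addKr 1) u1 addr0; apply/commrN/commr1.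
pose w := Units (hD nz).
have Uw : U w by apply: (Usub.2 1%g u) => //; apply: subgroup1.
have conjE v : val v * val (a ^ v)%g = val a * val v.
  by have /(congr1 val) := conjgC a v.
have [Nu Nw] := (nNU _ _ Na Uu, nNU _ _ Na Uw).
have e : val u * (val (a ^ u)%g - val (a ^ w)%g) = val (a ^ w)%g - val a.
  have : (1 + val u) * val (a ^ w)%g = val a * (1 + val u) by exact: (conjE w).
  rewrite mulrDl mulrDr mul1r mulr1 => h.
  by rewrite mulrBr conjE -[val a * _](addKr (val a)) -h addrA addrK addrC.
have cNv b : N b -> GRing.comm (val a) (val b) by move=> Nb; apply/commute_unitsP/cN.
have [eq12|ne12] := eqVneq (val (a ^ u)%g) (val (a ^ w)%g).
  move: e; rewrite eq12 subrr mulr0 => /esym/subr0_eq eaw.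
  by rewrite /GRing.comm -conjE eq12 eaw.
have nz12 : val (a ^ u)%g - val (a ^ w)%g != 0 by rewrite subr_eq0.
rewrite -[val u](mulrK (hD nz12)) e.
by apply: commrM; [|apply: commrV]; apply: commrB; do ?[exact: cNv|exact: commr_refl].
Qed.

Lemma class2_chain_central r (N : nat -> set (units D)) :
  (forall k, (k < r)%N -> is_normal (N k) (N k.+1)) -> N r = U -> is_subgroup (N 0%N) ->
  (forall a b c, N 0%N a -> N 0%N b -> N 0%N c -> commute [~ a, b]%g c) ->
  forall a u, N 0%N a -> U u -> commute a u.
Proof.
elim/ltn_ind: r N => r IHr N nN Nr sN N2.
have Nle j k : (j <= k <= r)%N -> (N j `<=` N k)%classic.
  elim: k => [|k IHk]; first by rewrite leqn0 => /andP[/eqP-> _].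
  case/andP; rewrite leq_eqVlt => /predU1P[-> _ x //|lejk] ltkr x Nx.
  by have [_ _ sub _] := nN _ ltkr; apply/sub/IHk => //; rewrite -ltnS lejk ltnW.
have Nsub j : (j <= r)%N -> (N 0%N `<=` N j)%classic by move=> lejr; apply: Nle.
have NU a : N 0%N a -> U a by rewrite -Nr; apply: Nsub.
(* [r] commutators lead from [U] into [N 0]; two more give 1, commutators of [N 0] being central in
   it. *)
have engelU a u : N 0%N a -> U u -> engel a r.+2 u = 1%g.
  move=> Na Uu; have := @engel_chain _ N r a r u nN Na; rewrite Nr subnn => /(_ Uu (leqnn r)) Nz.
  rewrite -[engel a r.+2 u]/[~ [~ engel a r u, a], a]%g.
  by apply/eqP/commgP/N2.
have cN a b : N 0%N a -> N 0%N b -> commute a b.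
  move=> Na Nb; apply/commute_sym/commgP/eqP.
  apply: (engel_central_commutator_eq1 hD Usub (NU _ Na) (NU _ Nb) _ _ (engelU a ^~ Na));
    exact: N2.
case: r IHr nN Nr Nle Nsub engelU => [|[|r]] IHr nN Nr Nle Nsub engelU.
- by move=> a u; rewrite -Nr; apply: cN.
- by apply: normal_abelian_central => //; rewrite -Nr; apply: nN.
have [_ _ _ n01] := nN 0%N isT; have [sN1 sN2 s12 n12] := nN 1%N isT.
(* By normality [[~ b ^ g, a]] lies in the abelian [N 0], so it commutes with [a]. It is also the
   conjugate by [g] of [[~ b, a ^ g^-1]], again in [N 0], so it commutes with [b ^ g]. *)
have cNJ a b g : N 0%N a -> N 0%N b -> N 2%N g -> commute a (b ^ g)%g.
  move=> Na Nb Ng; have N1bg : N 1%N (b ^ g)%g by apply: n12 => //; apply: (Nsub 1%N).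
  have N1a : N 1%N a by apply: (Nsub 1%N).
  have Nc : N 0%N [~ b ^ g, a]%g.
    by rewrite commgEr; apply: (subgroupM sN) => //; apply: n01 => //; apply: (subgroupV sN).
  apply/commute_sym/commgP/eqP.
  apply: (engel_central_commutator_eq1 hD Usub (NU _ Na) _ _ _ (engelU a ^~ Na)).
  - by rewrite -Nr; apply: (Nle 1%N) => //; rewrite leqnn.
  - exact: cN.
  - have Nd : N 0%N [~ b, a ^ g^-1]%g.
      rewrite commgEl; apply: (subgroupM sN); first exact: (subgroupV sN).
      apply: n01 => //; apply: n12 => //; exact: (subgroupV sN2).
    have -> : [~ b ^ g, a]%g = ([~ b, a ^ g^-1] ^ g)%g by rewrite conjRg conjgKV.
    by rewrite /commute -!conjMg cN.
pose S := [set u | exists b g, [/\ N 0%N b, N 2%N g & u = b ^ g]%g]%classic.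
have cS u v : S u -> S v -> commute u v.
  move=> [b [g [Nb Ng ->]]] [b' [g' [Nb' Ng' ->]]].
  have := cNJ b b' (g' * g^-1)%g Nb Nb' (subgroupM sN2 Ng' (subgroupV sN2 Ng)).
  by rewrite /commute => /(congr1 (fun u => u ^ g)%g); rewrite (conjMg b) (conjMg (_ ^ _)%g)
     -conjgM mulgVK.
have cgS u v : generated S u -> generated S v -> commute u v.
  move=> gu gv; apply: (generated_commute _ gv) => w Sw; apply/commute_sym.
  by apply: (generated_commute _ gu) => w' Sw'; apply: cS.
have N0S b : N 0%N b -> S b.
  by move=> Nb; exists b, 1%g; rewrite conjg1; split=> //; apply: subgroup1.
(* The normal closure replaces both [N 0] and [N 1], so the chain is one step shorter. *)
pose M k := if k is j.+1 then N j.+2 else generated S.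
have sGS : is_subgroup (generated S) by apply: generated_subgroup.
have nGS : is_normal (generated S) (N 2%N).
  split=> // [|x y Sx Ny].
    apply: generated_sub => // _ [b [g [Nb Ng ->]]].
    by apply: subgroupJ => //; apply: (Nsub 2%N).
  apply: (@generatedJ _ S (generated S) y sGS _ x Sx) => _ [b [g [Nb Ng ->]]].
  by apply: sub_generated; exists b, (g * y)%g; rewrite conjgM; split=> //; apply: subgroupM.
move=> a u Na; apply: (IHr r.+1 (leqnn _) M) => //.
- by move=> [_|k ltkr] //; apply: nN.
- move=> x y z Sx Sy _; have /commgP/eqP-> := cgS x y Sx Sy.
  exact/commute_sym/commute1.
- by apply: sub_generated; apply: N0S.
Qed.

Lemma solvable_subnormal_central (G : set (units D)) :
  is_subnormal G U -> is_solvable G -> forall a u, G a -> U u -> commute a u.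
Proof.
move=> nG [n Gn] a; have [sG _ [r0 [N0 [N00 N0r nN0]]]] := nG.
have GU : (G `<=` U)%classic.
  have Nle k : (k <= r0)%N -> (G `<=` N0 k)%classic.
    elim: k => [|k IHk ltkr x /(IHk (ltnW ltkr))]; first by move=> _ x; rewrite N00.
    by have [_ _ sub _] := nN0 _ ltkr; apply: sub.
  by rewrite -N0r; apply: Nle; apply: leqnn.
suff : forall k, (k <= n)%N -> forall a u, derived G (n - k) a -> U u -> commute a u.
  by move=> /(_ n (leqnn n)); rewrite subnn; apply.
elim=> [_ b u|k IHk ltkn].
  by rewrite subn0 Gn => -> _; apply/commute_sym/commute1.
have [sGk _ [r [N [N0k Nr nN]]]] := subnormal_derived (n - k.+1) nG.
rewrite -N0k; apply: (class2_chain_central nN Nr); rewrite N0k // => x y z Gx Gy Gz.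
apply: IHk; first exact: ltnW.
  by rewrite -subnSK //; apply: mem_derivedS.
by apply/GU/(derived_sub sG)/Gz.
Qed.

End SolvableSubnormal.

(** * Linear dependence over the center *)

Lemma maximal_seq (T : Type) (P : seq T -> Prop) n :
  P [::] -> (forall s, P s -> (size s <= n)%N) ->
  exists2 s, P s & forall x, ~ P (x :: s).
Proof.
move=> P0 Pn; apply: contrapT => nmax.
suff [s Ps sn] : exists2 s, P s & size s = n.+1 by have := Pn s Ps; rewrite sn ltnn.
elim: n.+1 => [|k [s Ps sk]]; first by exists [::].
apply: contrapT => nex; apply: nmax; exists s => // x Pxs.
by apply: nex; exists (x :: s) => //=; rewrite sk.
Qed.

Section Span.
Local Open Scope ring_scope.
Local Open Scope classical_set_scope.
Variables (D : unitRingType) (hD : is_division_ring D).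
Implicit Types (x y z c : D) (s t : seq D) (X Y Z : set D) (n m : nat) (u v g : units D).

Lemma centerV c : center D c -> center D c^-1.
Proof. by move=> cc x; apply/commr_sym/commrV/commr_sym/cc. Qed.

Lemma centerM c c' : center D c -> center D c' -> center D (c * c').
Proof. by move=> cc cc' x; apply/commr_sym/commrM; apply/commr_sym; [apply: cc|apply: cc']. Qed.

Lemma centerD c c' : center D c -> center D c' -> center D (c + c').
Proof. by move=> cc cc' x; apply/commr_sym/commrD; apply/commr_sym; [apply: cc|apply: cc']. Qed.

Lemma centerN c : center D c -> center D (- c).
Proof. by move=> cc x; apply/commr_sym/commrN/commr_sym/cc. Qed.

Lemma center1 : center D 1.
Proof. by move=> x; rewrite mul1r mulr1. Qed.

Lemma center0 : center D 0.
Proof. by move=> x; rewrite mul0r mulr0. Qed.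

Inductive lspan X : D -> Prop :=
| lspan0 : lspan X 0
| lspanZD c x y : center D c -> X x -> lspan X y -> lspan X (c * x + y).

Lemma lspan_id X x : X x -> lspan X x.
Proof.
move=> Xx; rewrite -[x]mul1r -[_ * _]addr0; apply: lspanZD => //; last exact: lspan0.
exact: center1.
Qed.

Lemma lspanD X x y : lspan X x -> lspan X y -> lspan X (x + y).
Proof.
move=> Lx Ly; elim: Lx => [|c x' y' cc Xx' _ IH]; first by rewrite add0r.
by rewrite -addrA; apply: lspanZD.
Qed.

Lemma lspanZ X c x : center D c -> lspan X x -> lspan X (c * x).
Proof.
move=> cc; elim=> [|c' x' y' cc' Xx' _ IH]; first by rewrite mulr0; apply: lspan0.
by rewrite mulrDr mulrA; apply: lspanZD => //; apply: centerM.
Qed.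

Lemma lspanN X x : lspan X x -> lspan X (- x).
Proof. by rewrite -mulN1r; apply: lspanZ; apply/centerN/center1. Qed.

Lemma lspanB X x y : lspan X x -> lspan X y -> lspan X (x - y).
Proof. by move=> Lx /lspanN; apply: lspanD. Qed.

Lemma lspan_sum X (I : eqType) (r : seq I) (F : I -> D) :
  (forall i, i \in r -> lspan X (F i)) -> lspan X (\sum_(i <- r) F i).
Proof.
move=> LF; rewrite big_seq; apply: big_ind => //; first exact: lspan0.
by move=> x y; apply: lspanD.
Qed.

Lemma lspan_trans X Y : (forall x, X x -> lspan Y x) -> forall x, lspan X x -> lspan Y x.
Proof.
move=> XY x; elim=> [|c x' y' cc /XY Lx' _ IH]; first exact: lspan0.
by apply: lspanD => //; apply: lspanZ.
Qed.

Lemma lspanS X Y : X `<=` Y -> forall x, lspan X x -> lspan Y x.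
Proof. by move=> XY; apply: lspan_trans => x /XY; apply: lspan_id. Qed.

Lemma lspanM X Y Z : (forall x y, X x -> Y y -> lspan Z (x * y)) ->
  forall x y, lspan X x -> lspan Y y -> lspan Z (x * y).
Proof.
move=> XYZ x y Lx Ly; elim: Lx => [|c x' z cc Xx' _ IH]; first by rewrite mul0r; apply: lspan0.
rewrite mulrDl -mulrA; apply: lspanD => //; apply: lspanZ => //.
elim: Ly => [|c' y' w cc' Yy' _ IHy]; first by rewrite mulr0; apply: lspan0.
rewrite mulrDr mulrA -cc' -mulrA; apply: lspanD => //; apply: lspanZ => //.
exact: XYZ.
Qed.

Lemma lspan_comm X y : (forall x, X x -> GRing.comm y x) ->
  forall x, lspan X x -> GRing.comm y x.
Proof.
move=> cX x; elim=> [|c x' z cc /cX yx' _ yz]; first exact: commr0.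
by apply: commrD => //; apply: commrM => //; apply/commr_sym/cc.
Qed.

Definition span s := lspan [set x | x \in s].

Lemma span_nil x : span [::] x -> x = 0.
Proof. by elim=> // c y z _ /=; rewrite in_nil. Qed.

Lemma span_cons y s x :
  span (y :: s) x -> exists c z, [/\ center D c, span s z & x = c * y + z].
Proof.
elim=> [|c x' z cc /= Xx' _ [c' [z' [cc' sz' ->]]]].
  by exists 0, 0; split; [exact: center0|exact: lspan0|rewrite mul0r addr0].
move: Xx'; rewrite inE => /predU1P[->|x's].
  by exists (c + c'), z'; split=> //; [apply: centerD|rewrite mulrDl addrA].
exists c', (c * x' + z'); split=> //; last by rewrite addrCA.
exact: lspanZD.
Qed.

Fixpoint free s : Prop := if s is x :: s' then ~ span s' x /\ free s' else True.

(** Let [c] be the coefficient of [x] on the head [y] of [t]. If [c] is nonzero, [x] replaces [y];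
    otherwise the search goes on in the rest of [t], which cannot run out since [x] is outside the
    span of [s]. *)
Lemma span_exchange x s t : span (s ++ t) x -> ~ span s x ->
  exists2 t', (size t' < size t)%N & forall y, y \in s ++ t -> span (x :: s ++ t') y.
Proof.
elim: t => [|y t IHt]; first by rewrite cats0.
have sub (s1 s2 : seq D) : {subset s1 <= s2} -> forall z, span s1 z -> span s2 z.
  by move=> s12; apply: lspanS => z; apply: s12.
have permP : perm_eq (s ++ y :: t) (y :: s ++ t) by rewrite perm_sym -cat1s perm_catCA.
move=> Lx nLx; have /span_cons[c [z [cc Lz xE]]] : span (y :: s ++ t) x.
  by apply: sub Lx => z; rewrite (perm_mem permP).
have id_sp (r : seq D) w : w \in r -> span r w by move=> rw; apply: lspan_id.
have [c0|c0] := eqVneq c 0.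
  have [t' lt Ht'] : exists2 t', (size t' < size t)%N &
      forall y, y \in s ++ t -> span (x :: s ++ t') y.
    by apply: IHt => //; rewrite xE c0 mul0r add0r.
  exists (y :: t') => // w; rewrite (perm_mem permP) inE => /predU1P[->|/Ht'].
    by apply: id_sp; rewrite !(inE, mem_cat) eqxx !orbT.
  by apply: sub => v; rewrite !(inE, mem_cat) => /or3P[] ->; rewrite ?orbT.
exists t => // w; rewrite (perm_mem permP) inE => /predU1P[->|wst]; last first.
  by apply: id_sp; rewrite inE wst orbT.
have -> : y = c^-1 * (x - z) by rewrite xE addrK mulKr //; apply: hD.
apply: lspanZ; first exact: centerV.
apply: lspanB; first by apply: id_sp; rewrite inE eqxx.
by apply: sub Lz => v; rewrite inE orbC => ->.
Qed.

Lemma steinitz s t : free s -> (forall x, x \in s -> span t x) -> (size s <= size t)%N.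
Proof.
(* Strengthened for the induction: [s] takes the place of part of [t] and leaves [t'], without loss
   of span. *)
move=> fs Hs; suff [t' le _] : exists2 t', (size s + size t' <= size t)%N &
    forall y, y \in t -> span (s ++ t') y.
  exact: leq_trans (leq_addr _ _) le.
elim: s fs Hs => [_ _|x s IHs [nx fs] Hs].
  by exists t => // y yt; apply: lspan_id.
have [y ys|t' le Ht'] := IHs fs; first by apply: Hs; rewrite inE ys orbT.
have Lx : span (s ++ t') x by apply: (lspan_trans Ht'); apply: Hs; rewrite inE eqxx.
have [t'' lt Ht''] := span_exchange Lx nx.
exists t''; first by apply: leq_trans le; rewrite addSnnS leq_add2l.
by move=> y /Ht'; apply: lspan_trans.
Qed.

(* [dimle X n]: the span of X over the center has dimension at most n. *)
Definition dimle X n := forall s, (forall x, x \in s -> X x) -> free s -> (size s <= n)%N.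

Lemma dimleS X Y n : X `<=` Y -> dimle Y n -> dimle X n.
Proof. by move=> XY dY s Xs; apply: dY => x /Xs/XY. Qed.

Lemma dimle_span X s : (forall x, X x -> span s x) -> dimle X (size s).
Proof. by move=> Xs t Xt ft; apply: steinitz => // x /Xt/Xs. Qed.

Lemma dimle_basis X n : dimle X n ->
  exists2 s, (forall x, x \in s -> X x) & forall x, X x -> span s x.
Proof.
move=> dX; have [||s [Xs fs] max] :=
  @maximal_seq _ (fun s => (forall x, x \in s -> X x) /\ free s) n; first by [].
  by move=> s [Xs fs]; apply: dX.
exists s => // x Xx; apply: contrapT => nx; apply: (max x); split=> // y.
by rewrite inE => /predU1P[->|/Xs].
Qed.

(** * Spans of the powers of one element *)

Definition powers x : set D := [set y | exists k, y = x ^+ k].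

Lemma powers_monoid x y z : powers x y -> powers x z -> powers x (y * z).
Proof. by move=> [k ->] [l ->]; exists (k + l)%N; rewrite exprD. Qed.

(** If [u^-1] is outside the span, no power of [u] is in the span of the higher ones, so there are
    free lists of powers of any length. *)
Lemma lspan_powersV u n : dimle (powers (val u)) n -> lspan (powers (val u)) (val u)^-1.
Proof.
move=> du; apply: contrapT => nV; have Uu := valP u.
have npow j : ~ lspan [set y | exists2 k, (j < k)%N & y = val u ^+ k] (val u ^+ j).
  move=> Lj; apply: nV.
  have -> : (val u)^-1 = (val u ^+ j.+1)^-1 * val u ^+ j.
    apply: (mulrI (unitrX j.+1 Uu)); rewrite mulrA divrr ?unitrX // mul1r exprSr -mulrA divrr //.
    by rewrite mulr1.
  apply: (lspanM _ (lspan_id (erefl : [set (val u ^+ j.+1)^-1] _)) Lj) => _ _ -> [k ltjk ->].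
  apply: lspan_id; exists (k - j.+1)%N; rewrite -{1}(subnKC ltjk) exprD mulKr //.
  exact: unitrX.
have main m j : exists s, [/\ forall x, x \in s -> exists2 k, (j <= k)%N & x = val u ^+ k,
                     free s & size s = m].
  elim: m j => [j|m IHm j]; first by exists [::].
  have [s [us fs sm]] := IHm j.+1; exists (val u ^+ j :: s); split=> [x||/=]; last by rewrite sm.
    by rewrite inE => /predU1P[->|/us[k /ltnW ? ->]]; [exists j|exists k].
  by split=> // Ls; apply: (npow j); apply: lspanS Ls => x /us.
have [s [us fs sn]] := main n.+1 0%N; suff : (size s <= n)%N by rewrite sn ltnn.
by apply: du => // x /us[k _ ->]; exists k.
Qed.

Lemma algebraic_dimle x : algebraic_over (center D) x -> exists n, dimle (powers x) n.
Proof.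
move=> [p [p0 cp /eqP px]]; pose d := (size p).-1; pose s := [seq x ^+ i | i <- iota 0 d].
have Ls i : (i < d)%N -> span s (x ^+ i).
  by move=> ltid; apply: lspan_id => /=; apply/mapP; exists i; rewrite ?mem_iota.
have Ld : span s (x ^+ d).
  have lp : lead_coef p \is a GRing.unit by apply: hD; rewrite lead_coef_eq0.
  have e : \sum_(i <- iota 0 d) p`_i * x ^+ i + lead_coef p * x ^+ d = 0.
    rewrite -[RHS]px horner_coef -(prednK (_ : 0 < size p)%N) ?size_poly_gt0 // big_ord_recr /= -/d.
    by rewrite -(big_mkord xpredT (fun i => p`_i * x ^+ i)) /index_iota subn0.
  have -> : x ^+ d = - (lead_coef p)^-1 * \sum_(i <- iota 0 d) p`_i * x ^+ i.
    apply: (mulrI lp); rewrite mulNr mulrN mulVKr //; apply/eqP.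
    by rewrite -addr_eq0 addrC e.
  apply: lspanZ; first exact/centerN/centerV/cp.
  apply: lspan_sum => i; rewrite mem_iota => /Ls; apply: lspanZ; exact: cp.
exists (size s); apply: dimle_span => _ [k ->].
elim: k => [|k IHk].
  case: (posnP d) => [d0|/Ls //]; by rewrite -d0.
rewrite exprS; apply: (lspanM _ (lspan_id (erefl : [set x] _)) IHk) => _ y -> /mapP[i].
rewrite mem_iota /= add0n => ltid ->; rewrite -exprS.
by move: ltid; rewrite leq_eqVlt => /predU1P[->|/Ls].
Qed.

End Span.

(** * Derived length of finite-dimensional solvable groups *)

Section Zassenhaus.
Local Open Scope ring_scope.
Local Open Scope classical_set_scope.
Variables (D : unitRingType) (hD : is_division_ring D).
Implicit Types (x y : D) (n m d : nat) (u v z g h a b : units D) (K B : set (units D)).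

(** The [n.+1] powers from [1] to [x ^+ n] cannot be free, so one of them is a combination of lower
    ones; this gives a monic polynomial of degree at most [n]. *)
Lemma dimle_poly x n : dimle (powers x) n ->
  exists p : {poly D}, [/\ p != 0, forall k, center D p`_k, root p x & (size p <= n.+1)%N].
Proof.
move=> dx; pose P j := [set y | exists2 k, (k < j)%N & y = x ^+ k].
have [j lejn Lj] : exists2 j, (j <= n)%N & lspan (P j) (x ^+ j).
  apply: contrapT => nL.
  have main m : (m <= n.+1)%N ->
      exists s, [/\ forall y, y \in s -> P m y, free s & size s = m].
    elim: m => [|m IHm ltmn]; first by exists [::].
    have [s [Ps fs sm]] := IHm (ltnW ltmn); exists (x ^+ m :: s); split=> [y||/=].
    - by rewrite inE => /predU1P[->|/Ps[k /ltnW ? ->]]; [exists m|exists k].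
    - by split=> // Ls; apply: nL; exists m => //; apply: lspanS Ls => y /Ps.
    - by rewrite sm.
  have [s [Ps fs sn]] := main n.+1 (leqnn _); suff : (size s <= n)%N by rewrite sn ltnn.
  by apply: dx => // y /Ps[k _ ->]; exists k.
have Pq y : lspan (P j) y ->
    exists q : {poly D}, [/\ forall k, center D q`_k, q.[x] = y & (size q <= j)%N].
  elim=> [|c _ w cc [k ltkj ->] _ [q [cq qx sq]]].
    by exists 0; split=> [k||]; rewrite ?coef0 ?horner0 ?size_poly0 //; exact: center0.
  exists (c%:P * 'X^k + q); split=> [i||].
  - rewrite coefD coefCM coefXn; apply: centerD => //.
    by case: eqP => _; rewrite ?mulr1 // mulr0; apply: center0.
  - by rewrite hornerD qx hornerCM hornerXn.
  - apply: leq_trans (size_polyD _ _) _; rewrite geq_max sq andbT mul_polyC.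
    by apply: leq_trans (size_scale_leq _ _) _; rewrite size_polyXn.
have [q [cq qx sq]] := Pq _ Lj; have sp : size ('X^j - q) = j.+1.
  by rewrite size_polyDl size_polyXn // size_polyN ltnS.
exists ('X^j - q); split; last by rewrite sp ltnS.
- by rewrite -size_poly_eq0 sp.
- move=> k; rewrite coefB coefXn; apply: centerD; last exact: centerN.
  by case: eqP => _; [apply: center1|apply: center0].
- by rewrite /root hornerD hornerN hornerXn qx subrr.
Qed.

Lemma conj_exp u g k : val (u ^ g)%g ^+ k = (val g)^-1 * val u ^+ k * val g.
Proof. by rewrite -!val_unitsX -conjXg conjgE /= mulrA. Qed.

Lemma root_conj (p : {poly D}) u g :
  (forall k, center D p`_k) -> root p (val u) -> root p (val (u ^ g)%g).
Proof.
move=> cp /eqP pu; rewrite /root horner_coef.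
have -> : \sum_(i < size p) p`_i * val (u ^ g)%g ^+ i = (val g)^-1 * p.[val u] * val g.
  rewrite horner_coef mulr_sumr mulr_suml; apply: eq_bigr => i _.
  by rewrite conj_exp !mulrA (cp i).
by rewrite pu mulr0 mul0r.
Qed.

Definition vset K : set D := [set x | exists2 u, K u & x = val u].

Lemma exp_bound (e d : nat) : (e <= d)%N -> (e.+1 ^ e <= d.+1 ^ d)%N.
Proof.
case: e => [|e] led; first by rewrite expn0 expn_gt0.
by apply: leq_trans (leq_pexp2l _ led); rewrite // leq_exp2r.
Qed.

(** A maximal list of pairwise inequivalent elements meets every class, and so provides the
    representatives for [solvable_orbit]. *)
Lemma solvable_orbit_card K (O : set (units D)) (eqv : units D -> units D -> Prop) d :
  is_subgroup K -> is_solvable K ->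
  (forall u g, O u -> K g -> O (u ^ g)%g) ->
  (forall u, eqv u u) ->
  (forall u v, eqv u v -> eqv v u) ->
  (forall u v w, eqv u v -> eqv v w -> eqv u w) ->
  (forall u v g, O u -> O v -> K g -> eqv u v -> eqv (u ^ g)%g (v ^ g)%g) ->
  (forall s : seq (units D), (forall u, u \in s -> O u) ->
     uniq s -> {in s &, forall u v, eqv u v -> u = v} -> (size s <= d)%N) ->
  forall g u, derived K (d.+1 ^ d) g -> O u -> eqv (u ^ g)%g u.
Proof.
move=> sK solK OJ eqvxx eqvC eqvT eqvJ Od.
pose P (s : seq (units D)) :=
  [/\ forall u, u \in s -> O u, uniq s & {in s &, forall u v, eqv u v -> u = v}].
have [||s [Os us es] max] := @maximal_seq _ P d; first by [].
  by move=> s [Os us es]; apply: Od.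
apply: (solvable_orbit (xs := s) sK solK OJ) => //; last exact/exp_bound/Od.
move=> u Ou; apply: contrapT => nu; apply: (max u).
have nus v : v \in s -> ~ eqv u v by move=> vs uv; apply: nu; exists v.
split=> [v||v w]; rewrite ?inE /=.
- by case/predU1P => [->|/Os].
- by rewrite us andbT; apply/negP => /nus; apply.
- move=> /predU1P[->|vs] /predU1P[->|ws] // uv; last exact: es.
    by case: (nus w).
  by case: (nus v vs); apply: eqvC.
Qed.

Lemma abelian_conj_central K d a :
  is_subgroup K -> is_solvable K -> dimle (vset K) d -> K a ->
  (forall g h, K g -> K h -> commute (a ^ g)%g (a ^ h)%g) ->
  forall g, derived K (d.+1 ^ d) g -> commute a g.
Proof.
move=> sK solK dK Ka aK g Dg.
have /dimle_poly[p [p0 cp pa sp]] : dimle (powers (val a)) d.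
  by apply: dimleS dK => _ [k ->]; exists (a ^+ k)%g; [exact: subgroupX|rewrite val_unitsX].
pose O := [set u | exists2 h, K h & u = (a ^ h)%g].
have : (a ^ g)%g = a.
  apply: (@solvable_orbit_card K O eq d sK solK) => // [_ h [k Kk ->] Kh|u v w ->||s Os us _|] //.
  - by exists (k * h)%g; rewrite ?conjgM //; apply: subgroupM.
  - by move=> u v h _ _ _ ->.
  - rewrite -ltnS; apply: leq_trans sp; rewrite -(size_map val).
    apply: (max_ring_poly_roots p0).
      by apply/allP=> _ /mapP[u /Os[h Kh ->] ->]; apply: root_conj.
    apply: (uniq_roots_comm hD); first by rewrite map_inj_uniq //; apply: val_inj.
    move=> _ _ /mapP[u /Os[h Kh ->] ->] /mapP[v /Os[h' Kh' ->] ->].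
    by apply/commute_unitsP/aK.
  - by exists 1%g; [exact: subgroup1|rewrite conjg1].
by move/conjg_fixP/commgP.
Qed.

Definition centralizes K (z : units D) := forall g, K g -> commute z g.

Lemma centralizes_subgroup K : is_subgroup (centralizes K : set (units D)).
Proof.
split=> [g _|z w cz cw g Kg|z cz g Kg]; first exact/commute_sym/commute1.
  by apply/commute_sym/commuteM; apply/commute_sym; [apply: cz|apply: cw].
by apply/commute_sym/commuteV/commute_sym/cz.
Qed.

(** * Subgroups that are abelian modulo the centralizer of [K] *)

Section CentralByAbelian.
Variables K B : set (units D).
Hypotheses (sB : is_subgroup B) (BK : B `<=` K).
Hypothesis commB : forall b b', B b -> B b' -> centralizes K [~ b, b']%g.
Hypothesis centB : forall z, B z -> centralizes B z -> centralizes K z.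

Let eqv u v := exists2 z, centralizes K z & (v = u * z)%g.

(* A shortest relation is shortened by conjugating it with x in B, which multiplies
   each b by the scalar [~ b, x]. *)
Lemma coset_reps_indep (s : seq (units D)) (c : units D -> D) :
  (forall u, u \in s -> B u) -> uniq s -> {in s &, forall u v, eqv u v -> u = v} ->
  (forall u, u \in s -> forall g, K g -> GRing.comm (c u) (val g)) ->
  \sum_(u <- s) c u * val u = 0 -> forall u, u \in s -> c u = 0.
Proof.
elim: s c => // b t IHt c Bs /= /andP[bt ut] es cs sum0.
have Bb : B b by apply: Bs; rewrite inE eqxx.
have Bt u : u \in t -> B u by move=> tu; apply: Bs; rewrite inE tu orbT.
have {}IHt c' : (forall u, u \in t -> forall g, K g -> GRing.comm (c' u) (val g)) ->
    \sum_(u <- t) c' u * val u = 0 -> forall u, u \in t -> c' u = 0.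
  by apply: IHt => // u v tu tv; apply: es; rewrite inE ?tu ?tv orbT.
have ct u : u \in t -> forall g, K g -> GRing.comm (c u) (val g).
  by move=> tu; apply: cs; rewrite inE tu orbT.
rewrite big_cons in sum0.
suff c0 u : u \in t -> c u = 0.
  move=> u; rewrite inE => /predU1P[->|/c0 //].
  move: sum0; rewrite big_seq big1 => [|v /c0->]; last by rewrite mul0r.
  by rewrite addr0 => /eqP; rewrite (div_mulf_eq0 hD) (negPf (val_units_neq0 b)) orbF => /eqP.
move=> tu; apply: contrapT => /eqP cu.
(* The relation conjugated by [x], minus the relation times [[~ b, x]], has no [b] term. By
   induction its coefficient at [u] vanishes, while [c u] does not. *)
have chi (x : units D) : B x -> [~ u, x]%g = [~ b, x]%g.
  move=> Bx.
  have cchi v g : B v -> K g -> GRing.comm (val [~ v, x]%g) (val g).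
    by move=> Bv Kg; apply/commute_unitsP/commB.
  pose c' v := c v * (val [~ v, x]%g - val [~ b, x]%g).
  apply/val_inj/subr0_eq/eqP.
  suff : c' u == 0 by rewrite (div_mulf_eq0 hD) (negPf cu).
  apply/eqP; apply: IHt => // [v tv g Kg|].
    apply/commr_sym/commrM; first exact/commr_sym/ct.
    by apply/commrB; apply/commr_sym/cchi => //; apply: Bt.
  have sumx : \sum_(v <- b :: t) c v * val [~ v, x]%g * val v = 0.
    apply: (mulrI (valP x)); rewrite mulr0 mulr_sumr.
    transitivity ((\sum_(v <- b :: t) c v * val v) * val x).
      rewrite mulr_suml !big_seq; apply: eq_bigr => v bv; have Bv := Bs v bv.
      have e : val v * val x = val x * (val [~ v, x]%g * val v).
        have e0 : val v * val x = val x * val v * val [~ v, x]%g := congr1 val (commgC v x).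
        by rewrite e0 (cchi v v Bv (BK Bv)) -(mulrA (val x)).
      rewrite -[RHS](mulrA (c v)) e [RHS]mulrA (cs v bv x (BK Bx)).
      by rewrite -(mulrA (c v)) -[RHS]mulrA.
    by rewrite big_cons sum0 mul0r.
  have sumb : \sum_(v <- b :: t) c v * val [~ b, x]%g * val v = 0.
    transitivity ((\sum_(v <- b :: t) c v * val v) * val [~ b, x]%g).
      rewrite mulr_suml !big_seq; apply: eq_bigr => v bv.
      rewrite -(mulrA (c v)) -[RHS](mulrA (c v)); congr (_ * _).
      exact: (cchi b v Bb (BK (Bs v bv))).
    by rewrite big_cons sum0 mul0r.
  have : \sum_(v <- b :: t) c' v * val v = 0.
    transitivity (\sum_(v <- b :: t) c v * val [~ v, x]%g * val v
                  - \sum_(v <- b :: t) c v * val [~ b, x]%g * val v).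
      by rewrite -sumrB; apply: eq_bigr => v _; rewrite /c' mulrBr mulrBl.
    by rewrite sumx sumb subr0.
  by rewrite big_cons /c' subrr mulr0 mul0r add0r.
(* By [chi], [u * b^-1] centralizes [B], hence [K] by [centB]; so [u] and [b] are equivalent, hence
   equal, although [b] is not in [t]. *)
have Bu := Bt u tu; have BuVb : B (u * b^-1)%g by apply: subgroupM => //; apply: subgroupV.
have cBub : centralizes B (u * b^-1)%g.
  move=> x Bx; apply/commgP/conjg_fixP; rewrite conjMg conjVg.
  have Jx v : (v ^ x = v * [~ v, x])%g by rewrite commgEl mulVKg.
  by rewrite (Jx u) (Jx b) chi // invgM mulgA mulgK.
have cKub := centB BuVb cBub.
have /es : eqv b u.
  exists (u * b^-1)%g => //; have := cKub b (BK Bb).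
  by rewrite /commute => <-; rewrite mulgVK.
rewrite !inE eqxx tu orbT => /(_ isT isT) bu; by rewrite bu tu in bt.
Qed.

Lemma coset_reps_free (s : seq (units D)) :
  (forall u, u \in s -> B u) -> uniq s -> {in s &, forall u v, eqv u v -> u = v} ->
  free (map val s).
Proof.
elim: s => //= b t IHt Bs /andP[bt ut] es; split; last first.
  apply: IHt => // [u tu|u v tu tv]; first by apply: Bs; rewrite inE tu orbT.
  by apply: es; rewrite inE ?tu ?tv orbT.
move=> Lb; have {}Lb : span (map val t) (val b) := Lb.
have [c cc bE] : exists2 c : units D -> D,
    forall u, center D (c u) & val b = \sum_(u <- t) c u * val u.
  move: (val b) Lb; elim: t ut {IHt Bs es bt} => [_|v t IHt /= /andP[vt ut]] y.
    move=> Ly; exists (fun=> 0); first by move=> u; exact: center0.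
    by rewrite big_nil; apply: span_nil.
  move=> /span_cons[c0 [z [cc0 /(IHt ut)[c cc zE] ->]]].
  exists (fun w => if w == v then c0 else c w); first by move=> w; case: eqP.
  rewrite big_cons eqxx zE; congr (_ + _); rewrite !big_seq; apply: eq_bigr => w wt.
  by case: eqP => // wv; rewrite -wv wt in vt.
pose c' u := if u == b then -1 else c u.
have cc' u : center D (c' u).
  by rewrite /c'; case: eqP => // _; apply/centerN/center1.
have sum0 : \sum_(u <- b :: t) c' u * val u = 0.
  rewrite big_cons /c' eqxx mulN1r bE; apply/eqP; rewrite addrC subr_eq0; apply/eqP.
  rewrite !big_seq; apply: eq_bigr => w wt.
  by case: eqP => // wb; rewrite -wb wt in bt.
have ubt : uniq (b :: t) by rewrite /= bt.
have := coset_reps_indep Bs ubt es (fun u _ g _ => cc' u (val g)) sum0 (mem_head b t).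
by rewrite /c' eqxx => /eqP; rewrite oppr_eq0 oner_eq0.
Qed.

(** Independence bounds the number of classes by [d], so [derived K (d.+1 ^ d)] preserves each
    class: it moves [b] to [b * z] with [z] centralizing [K]. Two such moves commute, so commutators
    fix [b], at the price of one more derived subgroup. *)
Lemma central_by_abelian_centralized d :
  is_subgroup K -> is_solvable K -> dimle (vset K) d ->
  (forall b g, B b -> K g -> B (b ^ g)%g) ->
  forall b g, B b -> derived K (d.+1 ^ d).+1 g -> commute b g.
Proof.
move=> sK solK dK BJ.
have sC := centralizes_subgroup K.
have orb g b : derived K (d.+1 ^ d) g -> B b -> eqv (b ^ g)%g b.
  apply: (@solvable_orbit_card K B eqv d sK solK) => //.
  - by move=> u; exists 1%g; [exact: subgroup1|rewrite mulg1].
  - by move=> u v [z cz ->]; exists z^-1%g; [exact: (subgroupV sC)|rewrite mulgK].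
  - move=> u v w [z cz ->] [z' cz' ->]; exists (z * z')%g; [exact: (subgroupM sC)|by rewrite mulgA].
  - move=> u v k Bu Bv Kk [z cz ->]; exists z => //; rewrite conjMg; congr (_ * _)%g.
    exact/conjg_fixP/commgP/cz.
  - move=> s Bs us es; rewrite -(size_map val); apply: dK; last exact: coset_reps_free.
    by move=> _ /mapP[u /Bs/BK Ku ->]; exists u.
have KD g : derived K (d.+1 ^ d) g -> K g by apply: derived_sub.
have conj_swap b g h : B b -> derived K (d.+1 ^ d) g -> derived K (d.+1 ^ d) h ->
    (b ^ (g * h) = b ^ (h * g))%g.
  move=> Bb Dg Dh.
  have orb' k : derived K (d.+1 ^ d) k -> exists z, [/\ K z, centralizes K z & b ^ k = b * z]%g.
    move=> Dk; have [z cz e] := orb _ _ Dk Bb.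
    have e' : (b ^ k = b * z^-1)%g by rewrite [in RHS]e mulgK.
    exists z^-1%g; split=> //; last exact: (subgroupV sC).
    rewrite -[z^-1%g](mulKg b) -e'; apply: subgroupM => //; first exact: (subgroupV sK (BK Bb)).
    exact: (subgroupJ sK (BK Bb) (KD _ Dk)).
  have [[z [Kz cz eg]] [w [Kw cw eh]]] := (orb' g Dg, orb' h Dh).
  rewrite !conjgM eg eh !conjMg eg eh.
  have -> : (z ^ h = z)%g by apply/conjg_fixP/commgP/cz/KD.
  have -> : (w ^ g = w)%g by apply/conjg_fixP/commgP/cw/KD.
  by rewrite -!mulgA cw.
have sD : is_subgroup (derived K (d.+1 ^ d)) by apply: derived_subgroup.
move=> b g Bb Dg.
apply: (@commutator_subset _ _ _ _ (subgroup_centralizer [set b]) _ g Dg b erefl).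
move=> x y Dx Dy _ ->; apply/commgP/conjg_fixP.
have -> : [~ x, y]%g = ((x^-1 * y^-1) * (y^-1 * x^-1)^-1)%g.
  by rewrite invgM !invgK commgEl conjgE !mulgA.
by rewrite conjgM conj_swap ?conjgK //; apply: (subgroupV sD).
Qed.
End CentralByAbelian.

(* If a deep derived subgroup of K has a smaller span, induct.  Otherwise it has the
   same centralizer as K; the last noncentral derived subgroup B has finite K-orbits,
   being abelian (conjugates are roots of one polynomial) or of class 2 (cosets of
   the center are independent), so B is centralized by it, hence central. *)
Lemma zassenhaus d : exists m, forall K,
  is_subgroup K -> is_solvable K -> dimle (vset K) d -> derived K m = [set 1%g].
Proof.
elim: d => [|d [m IHd]].
  exists 0%N => K sK _ dK; suff : (size [:: 1%R : D] <= 0)%N by [].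
  apply: dK => [x|]; last by split=> // /span_nil /eqP; rewrite oner_eq0.
  by rewrite inE => /eqP->; exists 1%g => //; apply: subgroup1.
(* [e] is the exponent of the orbit lemmas in dimension [d.+1]; [m0] adds the extra step of
   [central_by_abelian_centralized]. *)
pose e := (d.+2 ^ d.+1)%N; pose m0 := e.+1; exists (m0 + m)%N => K sK solK dK.
have sD0 : is_subgroup (derived K m0) by apply: derived_subgroup.
have [dKm|ndKm] := pselect (dimle (vset (derived K m0)) d).
  rewrite -derived_add; apply: IHd => //.
  exact: solvable_sub sD0 (derived_sub sK) solK.
have [s [Ds fs sd]] : exists s,
    [/\ forall x, x \in s -> vset (derived K m0) x, free s & (d < size s)%N].
  apply: contrapT => ns; apply: ndKm => s Ds fs; rewrite leqNgt; apply/negP => ds.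
  by apply: ns; exists s.
have Ks x : vset K x -> span s x.
  move=> Kx; apply: contrapT => nx; suff : (size (x :: s) <= d.+1)%N by rewrite /= leqNgt ltnS sd.
  apply: dK => // y; rewrite inE => /predU1P[->//|/Ds[u Du ->]].
  by exists u => //; apply: (derived_sub sK) Du.
(* [derived K m0] contains a list spanning [K], so whatever commutes with it commutes with [K]. *)
have hC z : (forall g, derived K m0 g -> commute z g) -> centralizes K z.
  move=> zD g Kg; apply/commute_unitsP; apply: (lspan_comm _ (Ks _ _)); last by exists g.
  by move=> _ /Ds[u Du ->]; apply/commute_unitsP/zD.
(* Once [derived K j.+1] centralizes [K], [derived K j] can serve as [B]. Its elements that
   centralize it have commuting conjugates, so [abelian_conj_central] and [hC] supply [centB]. *)
have cK j : derived K j `<=` centralizes K -> K `<=` centralizes K.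
  elim: j => // j IHj Dj; apply: IHj => b Db.
  have DK : derived K j `<=` K by apply: derived_sub.
  have sDj : is_subgroup (derived K j) by apply: derived_subgroup.
  have DJ u g : derived K j u -> K g -> derived K j (u ^ g)%g.
    by move=> Du Kg; apply: derivedJ Du => v Kv; apply: subgroupJ.
  apply: (hC) => g; apply: (central_by_abelian_centralized sDj DK) => // [u v Du Dv|z Dz cz].
    by apply: Dj; apply: mem_derivedS.
  apply: (hC) => h /(derived_le sK (leqnSn e)); apply: abelian_conj_central => //.
    exact: DK.
  move=> {g h} g h Kg Kh.
  have := cz _ (DJ _ _ Dz (subgroupM sK Kg (subgroupV sK Kh))).
  rewrite /commute => /(congr1 (fun u => u ^ h)%g).
  by rewrite (conjMg z) (conjMg (_ ^ _)%g) -conjgM mulgVK.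
have [l Kl] := solK.
have {}cK : K `<=` centralizes K.
  by apply: (cK l) => x; rewrite Kl => -> g _; apply/commute_sym/commute1.
apply: (derived_trivial sK (ltn0Sn _)); apply: derived_commute => // g h Kg; exact: cK.
Qed.

End Zassenhaus.

(** * Local finiteness of algebraic solvable groups *)

Section LocallyFinite.
Local Open Scope ring_scope.
Local Open Scope classical_set_scope.
Variables (D : unitRingType) (hD : is_division_ring D).
Implicit Types (x y : D) (n m d : nat) (u v g h a b : units D) (A K N T : set (units D)).
Implicit Types X : set D.

Lemma dimle_lspan X n : dimle X n -> exists m, dimle (lspan X) m.
Proof.
move=> /dimle_basis[s Xs sX]; exists (size s); apply: (dimle_span hD) => x.
exact: lspan_trans.
Qed.

Lemma lspan_unit_subring X n :
  X 1 -> (forall x y, X x -> X y -> X (x * y)) -> dimle X n ->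
  unit_subring [set u : units D | lspan X (val u)].
Proof.
move=> X1 XM /dimle_lspan[m dX].
have LM x y : lspan X x -> lspan X y -> lspan X (x * y).
  by apply: lspanM => x' y' Xx Xy; apply/lspan_id/XM.
split; [split=> [|u v Lu Lv|u Lu] /=|].
- exact: lspan_id.
- exact: LM.
- have Lpow x : powers (val u) x -> lspan X x.
    move=> [k ->]; elim: k => [|k IHk]; first exact: lspan_id.
    by rewrite exprS; apply: LM.
  have := lspan_powersV (dimleS Lpow dX); exact: lspan_trans.
- by move=> u v w Lu Lv /= ->; apply: lspanD.
Qed.

Lemma lspan_vset_unit_subring K n : is_subgroup K -> dimle (vset K) n ->
  unit_subring [set u : units D | lspan (vset K) (val u)].
Proof.
move=> sK; apply: lspan_unit_subring; first by exists 1%g => //; apply: subgroup1.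
by move=> _ _ [u Ku ->] [v Kv ->]; exists (u * v)%g => //; apply: subgroupM.
Qed.

Lemma subgroup_prod A T : is_subgroup A -> is_subgroup T ->
  (forall a h, A a -> T h -> A (a ^ h)%g) ->
  is_subgroup [set u | exists a h, [/\ A a, T h & u = a * h]%g].
Proof.
move=> sA sT AT; split.
- by exists 1%g, 1%g; split; [exact: subgroup1|exact: subgroup1|rewrite mulg1].
- move=> _ _ [a [h [Aa Th ->]]] [b [k [Ab Tk ->]]].
  exists (a * b ^ h^-1)%g, (h * k)%g; split; last first.
    by rewrite -(mulgA a) -[RHS](mulgA a) (mulgA h) (conjgCV h b) -(mulgA _ h).
  + exact: subgroupM.
  + by apply: subgroupM => //; apply: AT => //; apply: subgroupV.
- move=> _ [a [h [Aa Th ->]]]; exists (a^-1 ^ h)%g, h^-1%g; split.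
  + by apply: AT => //; apply: subgroupV.
  + exact: subgroupV.
  + by rewrite invgM conjgE -!mulgA mulgV mulg1.
Qed.

(** Finiteness is meant linearly: the subgroup generated by [t] may be infinite, but its span has
    finite dimension. *)
Definition locfin N := forall t : seq (units D), (forall u, u \in t -> N u) ->
  exists n, dimle (vset (generated [set u | u \in t])) n.

Lemma locfinS N K : N `<=` K -> locfin K -> locfin N.
Proof. by move=> NK lK t Nt; apply: lK => u /Nt/NK. Qed.

(** The entries of [l] are products [a * h] with [a] in a finite list [q] from [N] and [h] in [T],
    the group generated by [t]. The conjugates of [q] under [T] generate a group [A] of
    finite-dimensional span, and [l] generates a subgroup of the product [A T]. *)
Lemma locfin_adjoin K N t :
  is_subgroup K -> is_subgroup N -> (forall a g, N a -> K g -> N (a ^ g)%g) ->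
  K t -> (exists n, dimle (powers (val t)) n) -> locfin N ->
  locfin (generated (N `|` [set t])).
Proof.
move=> sK sN NK Kt [d dt] lN l Hl.
pose T := generated [set t]; have sT : is_subgroup T by apply: generated_subgroup.
have TK : T `<=` K by apply: generated_sub => // _ ->.
have [w w_pow Tw] := dimle_basis dt.
have {}Tw h : T h -> span w (val h).
  have [sLt _] : unit_subring [set u : units D | lspan (powers (val t)) (val u)].
    apply: lspan_unit_subring dt; first by exists 0%N.
    exact: powers_monoid.
  move=> Th; apply: (lspan_trans Tw); apply: (generated_sub sLt _ Th) => _ ->.
  by apply: lspan_id; exists 1%N.
have NT a h : N a -> T h -> N (a ^ h)%g by move=> Na /TK; apply: NK.
have [q Nq lq] : exists2 q : seq (units D), (forall a, a \in q -> N a) &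
    forall u, u \in l -> exists a h, [/\ a \in q, T h & u = a * h]%g.
  elim: l Hl => [_|u l IHl Hl]; first by exists [::].
  have [v lv|q Nq lq] := IHl; first by apply: Hl; rewrite inE lv orbT.
  have [a [h [Na Th ->]]] : exists a h, [/\ N a, T h & u = a * h]%g.
    apply: (generated_sub (subgroup_prod sN sT NT)) (Hl u (mem_head _ _)) => v [Nv|->].
      by exists v, 1%g; rewrite mulg1; split=> //; apply: subgroup1.
    by exists 1%g, t; rewrite mul1g; split=> //; [apply: subgroup1|apply: sub_generated].
  exists (a :: q) => [b|v]; first by rewrite inE => /predU1P[->|/Nq].
  rewrite inE => /predU1P[->|/lq[b [k [bq Tk ->]]]].
    by exists a, h; rewrite mem_head.
  by exists b, k; rewrite inE bq orbT.
pose Q := [set u | exists a h, [/\ a \in q, T h & u = a ^ h]%g].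
pose r := [seq x * y | x <- [seq x * val a | x <- w, a <- q], y <- w].
have Qr x : vset Q x -> span r x.
  move=> [_ [a [h [aq Th ->]]] ->].
  have -> : val (a ^ h)%g = val h^-1%g * val a * val h by rewrite conjgE mulgA.
  have Lwa : span [seq x * val a | x <- w, a <- q] (val h^-1%g * val a).
    apply: (lspanM _ (Tw _ (subgroupV sT Th)) (lspan_id (erefl : [set val a] _))) => x' _ wx ->.
    by apply: lspan_id; apply: allpairs_f.
  apply: (lspanM _ Lwa (Tw h Th)) => x' y' wx wy.
  by apply: lspan_id; apply: allpairs_f.
have [s' Qs' Qs] := dimle_basis (dimle_span hD Qr).
(* Finitely many conjugates [t'] span all of [Q]. The group they generate has a finite-dimensional
   span by [lN], and the units in that span form a group containing [A]. *)
have [t' Qt' t's'] : exists2 t' : seq (units D), (forall u, u \in t' -> Q u) & map val t' = s'.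
  elim: s' Qs' {Qs} => [|x s' IHs'] Qs'; first by exists [::].
  have [v s'v|t' Qt' <-] := IHs'; first by apply: Qs'; rewrite inE s'v orbT.
  have [u Qu ->] := Qs' x (mem_head _ _); exists (u :: t') => // v.
  by rewrite inE => /predU1P[->|/Qt'].
have [|n dn] := lN t'; first by move=> u /Qt'[a [h [/Nq Na Th ->]]]; apply: NT.
have [sU _] := lspan_vset_unit_subring (generated_subgroup _) dn.
set U := [set u | _] in sU.
have QU : Q `<=` U.
  move=> u Qu; have := Qs _ (ex_intro2 _ _ u Qu erefl : vset Q (val u)).
  apply: lspanS => x /=; rewrite -t's' => /mapP[v vt' ->]; exists v => //.
  exact: sub_generated.
pose A := generated Q; have sA : is_subgroup A by apply: generated_subgroup.
have AT a h : A a -> T h -> A (a ^ h)%g.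
  move=> Aa Th; apply: (generatedJ sA _ Aa) => _ [b [k [bq Tk ->]]].
  apply: sub_generated; exists b, (k * h)%g; rewrite conjgM; split=> //.
  exact: (subgroupM sT Tk Th).
have [s'' _ Us''] := dimle_basis dn.
have As'' a : A a -> span s'' (val a).
  by move=> Aa; apply: (lspan_trans Us''); apply: (generated_sub sU QU).
pose z := [seq x * y | x <- s'', y <- w].
exists (size z); apply: (dimle_span hD) => _ [u lu ->].
have [a [h [Aa Th ->]]] : exists a h, [/\ A a, T h & u = a * h]%g.
  apply: (generated_sub (subgroup_prod sA sT AT)) lu => v /lq[a [h [aq Th ->]]].
  exists a, h; split=> //; apply: sub_generated; exists a, 1%g; rewrite conjg1.
  by split=> //; apply: subgroup1.
apply: (lspanM _ (As'' a Aa) (Tw h Th)) => x' y' sx wy.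
by apply: lspan_id; apply: allpairs_f.
Qed.

(** Every subgroup between [derived K 1] and [K] is normal in [K], so [locfin_adjoin] can adjoin the
    entries of [t] one at a time. *)
Lemma locfin_derived1 K : is_subgroup K ->
  (forall u, K u -> exists n, dimle (powers (val u)) n) ->
  locfin (derived K 1) -> locfin K.
Proof.
move=> sK algK lK1 t Kt.
suff /(_ t) lt : locfin (generated (derived K 1 `|` [set u | u \in t])).
  by apply: lt => u ut; apply: sub_generated; right.
elim: t Kt => [_|u t IHt Kut].
  apply: locfinS lK1; apply: generated_sub; first exact: derived_subgroup.
  by move=> u [].
have Kt v : v \in t -> K v by move=> vt; apply: Kut; rewrite inE vt orbT.
have Ku : K u by apply: Kut; rewrite mem_head.
set N := generated (derived K 1 `|` [set u | u \in t]) in IHt.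
have sN : is_subgroup N by apply: generated_subgroup.
have NK : N `<=` K.
  by apply: generated_sub => // v [/(derived_sub sK)|/Kt].
have NJ a g : N a -> K g -> N (a ^ g)%g.
  move=> Na Kg; rewrite -[(a ^ g)%g](mulVKg a) -commgEl; apply: (subgroupM sN) => //.
  by apply: sub_generated; left; apply: mem_derivedS => //; apply: NK.
apply: locfinS (locfin_adjoin sK sN NJ Ku (algK u Ku) (IHt Kt)).
apply: generated_sub; first exact: generated_subgroup.
move=> v [Dv|]; first by apply: sub_generated; left; apply: sub_generated; left.
rewrite /= inE => /predU1P[->|vt]; first by apply: sub_generated; right.
by apply: sub_generated; left; apply: sub_generated; right.
Qed.

Lemma solvable_locfin K : is_subgroup K -> is_solvable K ->
  (forall u, K u -> exists n, dimle (powers (val u)) n) -> locfin K.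
Proof.
move=> sK [n Kn] algK.
suff : forall k, (k <= n)%N -> locfin (derived K (n - k)).
  by move=> /(_ n (leqnn n)); rewrite subnn.
elim=> [_|k IHk ltkn].
  rewrite subn0 Kn => t Ht; exists (size [:: 1%R : D]); apply: (dimle_span hD) => _ [u gu ->].
  suff -> : u = 1%g by apply: lspan_id; rewrite /= mem_head.
  have s1 : is_subgroup [set 1%g : units D].
    by split=> [|x y -> ->|x ->]; rewrite /= ?mulg1 ?invg1.
  exact: (generated_sub s1) gu.
have sD : is_subgroup (derived K (n - k.+1)) by apply: derived_subgroup.
apply: locfin_derived1 => // [u /(derived_sub sK) /algK //|].
by rewrite -[derived _ 1]/(derived K (n - k.+1).+1) subnSK //; apply/IHk/ltnW.
Qed.

Lemma locally_solvable_algebraic_abelian (H : set (units D)) :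
  is_subnormal H [set: units D] -> locally_solvable H ->
  (forall u, H u -> algebraic_over (center D) (val u)) ->
  forall x y : units D, H x -> H y -> commute x y.
Proof.
move=> nH solH algH x y Hx Hy; have sH : is_subgroup H by case: nH.
pose K0 := generated [set u | u \in [:: x; y]].
have sK0 : is_subgroup K0 by apply: generated_subgroup.
have K0H : K0 `<=` H.
  by apply: generated_sub => // u; rewrite /= !inE => /orP[/eqP->|/eqP->].
have solK0 : is_solvable K0 by apply: solH => //; exists [:: x; y].
have [n dK0] : exists n, dimle (vset K0) n.
  apply: (solvable_locfin sK0 solK0) => u; last first.
    by move=> ut; apply: sub_generated.
  by move=> /K0H/algH/(algebraic_dimle hD).
pose U := [set u : units D | lspan (vset K0) (val u)].
have subU : unit_subring U := lspan_vset_unit_subring sK0 dK0.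
have [sU _] := subU.
have [d dU] := dimle_lspan dK0; have [m Hm] := zassenhaus hD d.
have nM : is_subnormal (H `&` U) U by apply: subnormal_setIT.
have solM : is_solvable (H `&` U).
  (* The bound [m] depends only on [d]. An element of the [m]-th derived subgroup already lies in
     that of a finitely generated subgroup, which is trivial. *)
  exists m; apply/seteqP; split=> [u /derived_generated[t Mt]|_ ->]; last first.
    exact: (subgroup1 (derived_subgroup m (subgroupI sH sU))).
  have sK : is_subgroup (generated [set v | v \in t]) by apply: generated_subgroup.
  have KM : generated [set v | v \in t] `<=` H `&` U.
    by apply: generated_sub; [apply: subgroupI|move=> v /Mt].
  rewrite Hm //; first by apply: solH => //; [move=> v /KM[]|exists t].
  by apply: dimleS dU => _ [v /KM[_ Uv] ->].
have K0U u : K0 u -> U u by move=> K0u; apply: lspan_id; exists u.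
have [K0x K0y] : K0 x /\ K0 y by split; apply: sub_generated; rewrite /= !inE eqxx ?orbT.
by apply: (solvable_subnormal_central hD subU nM solM); [split|]; do ?apply: K0U.
Qed.

End LocallyFinite.

Theorem theorem2p5 (D : unitRingType) (hD : is_division_ring D)
    (G : set (units D))
    (hsub : is_subnormal G [set: units D]%classic)
    (hsol : locally_solvable G)
    (i : nat) (hi : 0 < i)
    (halg : forall u : units D, derived G i u -> algebraic_over (center D) (u : D)) :
  forall u : units D, G u -> center D (u : D).
Proof.
have sG : is_subgroup G by case: hsub.
have abelian_Gi x y : derived G i x -> derived G i y -> commute x y.
  apply: (locally_solvable_algebraic_abelian hD) halg _ _.
    exact: subnormal_derived.
  by move=> K sK KGi; apply: hsol => // v /KGi; apply: derived_sub.
have solG : is_solvable G by exists i.+1; apply: derived_commute.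
have setT_subring : unit_subring [set: units D]%classic by split.
move=> u Gu y; have [->|y0] := eqVneq y 0%R; first by rewrite mulr0 mul0r.
by have /(congr1 val) :=
  solvable_subnormal_central hD setT_subring hsub solG Gu (I : setT (Units (hD y y0))).
Qed.
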